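(* Let $N=2n$ be even. There is a grading-preserving unitary isomorphism of $\mathfrak{sl}_2$-modules between $(V_N^*,\widetilde{\deg})$ and $(\mathcal X_N,\operatorname{maj})$ such that, writing $V_N^*=\bigoplus_{k=0}^n M_{2k+1}\otimes\mathcal M_k$, the multiplicity space $\mathcal M_k$ is (under this isomorphism) spanned by the standard Young tableaux $\tau$ of shape $(n+k,n-k)$, and hence $\mathcal M_k[i]$ is spanned by those $\tau$ of shape $(n+k,n-k)$ with $\operatorname{maj}(\tau)=i$.
   Context: Fusion product. Let $\rho_1=\dots=\rho_N$ be the two-dimensional irreducible representation $\mathbb C^2$ of $\mathfrak{sl}_2$ with lowest weight vector $v_0$, and let $z_1,\dots,z_N\in\mathbb C$ be pairwise distinct. For $z\in\mathbb C$, the evaluation representation $\rho(z)$ of $\mathfrak{sl}_2\otimes\mathbb C[t]$ is given by $(x\otimes t^i)v=z^i\,xv$. Let $V_N$ be the space of $\rho_1(z_1)\otimes\cdots\otimes\rho_N(z_N)$. Let $e$ be the raising operator of $\mathfrak{sl}_2$, $e_j=e\otimes t^j$, let $V_N^{(m)}$ be the span of the vectors $e_{i_1}\cdots e_{i_l}(v_0\otimes\cdots\otimes v_0)$ with $i_1+\dots+i_l=m$, and let $V_N^{(\le m)}=\sum_{j\le m}V_N^{(j)}$. The fusion product is $V_N^*=\operatorname{gr}V_N=\bigoplus_{m\ge0}V_N^*[m]$ with $V_N^*[m]=V_N^{(\le m)}/V_N^{(\le m-1)}$ (and $V_N^{(\le-1)}=0$); the degree with respect to this grading is denoted $\widetilde{\deg}$.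 It is known that $V_N^*$ is an $\mathfrak{sl}_2\otimes(\mathbb C[t]/t^N)$-module that does not depend on the choice of pairwise distinct $z_j$, with elements $x\otimes t^l$ sending $V_N^*[m]$ to $V_N^*[m+l]$, and that $V_N^*\simeq(\mathbb C^2)^{\otimes N}$ as an $\mathfrak{sl}_2$-module. $V_N^*$ is equipped with an inner product such that the corresponding representation of $\mathfrak{sl}_2$ is unitary. $V_N^*=\bigoplus_{k=0}^n M_{2k+1}\otimes\mathcal M_k$ is its decomposition into irreducible $\mathfrak{sl}_2$-modules, $M_{2k+1}$ being the $(2k+1)$-dimensional irreducible module and $\mathcal M_k$ the multiplicity space; $\mathcal M_k=\bigoplus_{i\ge0}\mathcal M_k[i]$ is the grading inherited from $V_N^*$. Symmetric group side. $H_{\pi_k}$ is the space of the irreducible representation of $\mathfrak S_N$ with Young diagram $(n+k,n-k)$, spanned by the standard Young tableaux of shape $(n+k,n-k)$; $\mathcal X_N=\bigoplus_{k=0}^nM_{2k+1}\otimes H_{\pi_k}$, equipped with the standard inner product, with $\mathfrak{sl}_2$ acting on the first factors. The major index of a standard tableau $\tau$ with $N$ cells is $\operatorname{maj}(\tau)=\sum i$ over all $i\le N-1$ such that $i+1$ lies lower in $\tau$ than $i$. It defines a grading on $H_{\pi_k}$, and hence on $\mathcal X_N$: $u\otimes\tau$ with $u\in M_{2k+1}$ has degree $\operatorname{maj}(\tau)$.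
   Formalization: The inner product on V_N^* is additionally assumed to make the homogeneous components V_N^*[m] mutually orthogonal; unitarity of the sl_2-representation alone does not suffice (e.g. N=4), and this orthogonality is necessary for a grading-preserving unitary isomorphism. *)

(* Defs.v *)
From HB Require Import structures.
From mathcomp Require Import all_boot all_order all_algebra.
From mathcomp Require Import generic_quotient ring_quotient.
From mathcomp Require Import mathcomp_extra boolp classical_sets.
From mathcomp Require Import reals.
From mathcomp Require Import complex ring.

Set Implicit Arguments.
Unset Strict Implicit.
Unset Printing Implicit Defensive.

Import Order.TTheory GRing.Theory Num.Theory Num.Def.
Local Open Scope ring_scope.
Local Open Scope quotient_scope.

Section SpanSet.
Variables (K : fieldType) (V : vectType K).
Implicit Type A : set V.

Definition span_dims A : pred nat := fun d =>
  `[< exists2 s : seq V, (forall x, x \in s -> A x) & \dim <<s>>%VS = d >].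

Lemma span_dims_ex A : exists d, span_dims A d.
Proof. by exists 0%N; apply/asboolP; exists [::] => //; rewrite span_nil dimv0. Qed.

Lemma span_dims_le A d : span_dims A d -> (d <= \dim {:V})%N.
Proof. by case/asboolP=> s _ <-; apply/dimvS/subvf. Qed.

Lemma spanset_key A : exists U : {vspace V}, `[< exists2 s : seq V,
  (forall x, x \in s -> A x) &
  U = <<s>>%VS /\ \dim <<s>>%VS = ex_maxn (span_dims_ex A) (@span_dims_le A) >].
Proof.
case: ex_maxnP => d /asboolP[s sA sd] _.
by exists <<s>>%VS; apply/asboolP; exists s.
Qed.

(* The linear span of an arbitrary set of vectors; characterized by
   [spanset_sub] and [spanset_min]. *)
Definition spanset A : {vspace V} := xchoose (spanset_key A).

Lemma spanset_min A (U : {vspace V}) :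
  (forall x, A x -> x \in U) -> (spanset A <= U)%VS.
Proof.
move=> AU; rewrite /spanset; have /asboolP[s sA [-> _]] := xchooseP (spanset_key A).
by apply/span_subvP => x /sA /AU.
Qed.

Lemma spanset_sub A x : A x -> x \in spanset A.
Proof.
move=> Ax; rewrite /spanset; have /asboolP[s sA [-> sd]] := xchooseP (spanset_key A).
have dle : (\dim <<x :: s>>%VS <= \dim <<s>>%VS)%N.
  rewrite {}sd; case: ex_maxnP => d _; apply; apply/asboolP.
  by exists (x :: s) => // y; rewrite inE => /orP[/eqP->|/sA].
have sub : (<<s>> <= <<x :: s>>)%VS by rewrite span_cons addvSr.
have /eqP -> : <<s>>%VS == <<x :: s>>%VS by rewrite eqEdim sub.
by rewrite memv_span // mem_head.
Qed.

End SpanSet.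

Section QuotientModule.
Variables (K : fieldType) (V : vectType K) (U W : {vspace V}).

Definition qsub : {vspace subvs_of U} := (linfun vsval @^-1: W)%VS.

(* U / W, meant for W a subspace of U; in general U / (U :&: W). *)
Definition qmod := {ideal_quot pred_of_vspace qsub}.

HB.instance Definition _ := GRing.Zmodule.on qmod.
HB.instance Definition _ := EqQuotient.on qmod.

Definition qpi (u : subvs_of U) : qmod := \pi_qmod u.

Lemma qpiP u v : reflect (qpi u = qpi v) (vsval u - vsval v \in W).
Proof.
have -> : (vsval u - vsval v \in W) = (u - v \in qsub).
  by rewrite -[in RHS]memv_preim lfunE linearB.
by rewrite Quotient.idealrBE; apply: eqP.
Qed.

Lemma qpi_surj (q : qmod) : exists u, q = qpi u.
Proof. by exists (repr q); rewrite /qpi reprK. Qed.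

Lemma qpiD u v : qpi (u + v) = qpi u + qpi v.
Proof. by rewrite /qpi raddfD. Qed.

Definition qscale (a : K) (q : qmod) : qmod := qpi (a *: repr q).

Lemma qscale_pi a u : qscale a (qpi u) = qpi (a *: u).
Proof.
apply/qpiP; rewrite !linearZ /= -scalerDr memvZ //.
by apply/qpiP; rewrite /qpi reprK.
Qed.

Lemma qscaleA a b q : qscale a (qscale b q) = qscale (a * b) q.
Proof. by have [u ->] := qpi_surj q; rewrite !qscale_pi scalerA. Qed.
Lemma qscale1 : left_id 1 qscale.
Proof. by move=> q; have [u ->] := qpi_surj q; rewrite qscale_pi scale1r. Qed.
Lemma qscaleDr : right_distributive qscale +%R.
Proof.
move=> a q r; have [u ->] := qpi_surj q; have [v ->] := qpi_surj r.
by rewrite -qpiD !qscale_pi -qpiD scalerDr.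
Qed.
Lemma qscaleDl q : {morph qscale^~ q : a b / a + b}.
Proof.
by move=> a b; have [u ->] := qpi_surj q; rewrite !qscale_pi -qpiD scalerDl.
Qed.

HB.instance Definition _ :=
  GRing.Zmodule_isLmodule.Build K qmod qscaleA qscale1 qscaleDr qscaleDl.

Fact qpi_linear : linear qpi.
Proof. by move=> a u v; rewrite qpiD -qscale_pi. Qed.
HB.instance Definition _ := GRing.isLinear.Build K (subvs_of U) qmod _ qpi qpi_linear.

Section Induced.
Variable A : 'End(V).
Hypotheses (AU : (A @: U <= U)%VS) (AW : (A @: W <= W)%VS).

Definition qmap of (A @: U <= U)%VS & (A @: W <= W)%VS : qmod -> qmod :=
  fun q => qpi (vsproj U (A (vsval (repr q)))).

Lemma qmap_pi u : qmap AU AW (qpi u) = qpi (vsproj U (A (vsval u))).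
Proof.
have AUE (w : subvs_of U) : A (vsval w) \in U.
  by apply: (subvP AU); rewrite memv_img // subvsP.
apply/qpiP; rewrite !vsprojK // -linearB; apply: (subvP AW); apply: memv_img.
by apply/qpiP; rewrite /qpi reprK.
Qed.

Fact qmap_linear : linear (qmap AU AW).
Proof.
move=> a q r; have [u ->] := qpi_surj q; have [v ->] := qpi_surj r.
by rewrite -linearP !qmap_pi -linearP !linearP.
Qed.

End Induced.

HB.instance Definition _ A AU AW := GRing.isLinear.Build K qmod qmod _
  (@qmap A AU AW) (@qmap_linear A AU AW).

End QuotientModule.

Section DirectSum.
Variables (K : nzRingType) (Q : nat -> lmodType K).

Record dsum := Dsum {
  dsum_fun :> forall m, Q m;
  dsum_fin : exists D, forall m, (D <= m)%N -> dsum_fun m = 0 }.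

HB.instance Definition _ := gen_eqMixin dsum.
HB.instance Definition _ := gen_choiceMixin dsum.

Lemma dsumP (v w : dsum) : (forall m, v m = w m) -> v = w.
Proof.
case: v w => [v vP] [w wP] /= vw.
have evw : v = w by apply: functional_extensionality_dep.
by case: w / evw wP {vw} => wP; congr Dsum; apply: Prop_irrelevance.
Qed.

Fact dsum0_fin : exists D, forall m, (D <= m)%N -> 0 = 0 :> Q m.
Proof. by exists 0%N. Qed.
Definition dsum0 := Dsum dsum0_fin.

Fact dsumD_fin (v w : dsum) :
  exists D, forall m, (D <= m)%N -> v m + w m = 0.
Proof.
have [D vP] := dsum_fin v; have [E wP] := dsum_fin w; exists (maxn D E) => m.
by rewrite geq_max => /andP[Dm Em]; rewrite vP // wP // addr0.
Qed.
Definition dsumD v w := Dsum (dsumD_fin v w).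

Fact dsumN_fin (v : dsum) : exists D, forall m, (D <= m)%N -> - v m = 0.
Proof. by have [D vP] := dsum_fin v; exists D => m Dm; rewrite vP // oppr0. Qed.
Definition dsumN v := Dsum (dsumN_fin v).

Fact dsumZ_fin a (v : dsum) : exists D, forall m, (D <= m)%N -> a *: v m = 0.
Proof. by have [D vP] := dsum_fin v; exists D => m Dm; rewrite vP // scaler0. Qed.
Definition dsumZ a v := Dsum (dsumZ_fin a v).

Fact dsumDA : associative dsumD.
Proof. by move=> u v w; apply: dsumP => m /=; rewrite addrA. Qed.
Fact dsumDC : commutative dsumD.
Proof. by move=> v w; apply: dsumP => m /=; rewrite addrC. Qed.
Fact dsum0D : left_id dsum0 dsumD.
Proof. by move=> v; apply: dsumP => m /=; rewrite add0r. Qed.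
Fact dsumND : left_inverse dsum0 dsumN dsumD.
Proof. by move=> v; apply: dsumP => m /=; rewrite addNr. Qed.
HB.instance Definition _ := GRing.isZmodule.Build dsum dsumDA dsumDC dsum0D dsumND.

Fact dsumZA a b v : dsumZ a (dsumZ b v) = dsumZ (a * b) v.
Proof. by apply: dsumP => m /=; rewrite scalerA. Qed.
Fact dsum1Z : left_id 1 dsumZ.
Proof. by move=> v; apply: dsumP => m /=; rewrite scale1r. Qed.
Fact dsumZDr : right_distributive dsumZ +%R.
Proof. by move=> a v w; apply: dsumP => m /=; rewrite scalerDr. Qed.
Fact dsumZDl v : {morph dsumZ^~ v : a b / a + b}.
Proof. by move=> a b; apply: dsumP => m /=; rewrite scalerDl. Qed.
HB.instance Definition _ :=
  GRing.Zmodule_isLmodule.Build K dsum dsumZA dsum1Z dsumZDr dsumZDl.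

Lemma dsumDE (v w : dsum) m : (v + w) m = v m + w m. Proof. by []. Qed.
Lemma dsumNE (v : dsum) m : (- v) m = - v m. Proof. by []. Qed.
Lemma dsumZE a (v : dsum) m : (a *: v) m = a *: v m. Proof. by []. Qed.

Definition dsum_deg (m : nat) (v : dsum) : Prop :=
  forall m', m' != m -> v m' = 0.

Variable A : forall m, {linear Q m -> Q m}.

Fact dsum_map_fin (v : dsum) : exists D, forall m, (D <= m)%N -> A m (v m) = 0.
Proof. by have [D vP] := dsum_fin v; exists D => m Dm; rewrite vP // linear0. Qed.
Definition dsum_map v := Dsum (dsum_map_fin v).

Fact dsum_map_linear : linear dsum_map.
Proof. by move=> a v w; apply: dsumP => m; rewrite /= linearP. Qed.
HB.instance Definition _ := GRing.isLinear.Build K dsum dsum _ dsum_map dsum_map_linear.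

End DirectSum.

Record sl2rep (K : nzRingType) (V : lmodType K) := Sl2Rep {
  repE : {linear V -> V};
  repF : {linear V -> V};
  repH : {linear V -> V};
  repEF : forall v, repE (repF v) - repF (repE v) = repH v;
  repHE : forall v, repH (repE v) - repE (repH v) = 2%:R *: repE v;
  repHF : forall v, repH (repF v) - repF (repH v) = - 2%:R *: repF v }.

Definition sl2_hom (K : nzRingType) (V W : lmodType K) (rho : sl2rep V)
    (sigma : sl2rep W) (f : V -> W) : Prop :=
  [/\ forall v, f (repE rho v) = repE sigma (f v),
      forall v, f (repF rho v) = repF sigma (f v)
    & forall v, f (repH rho v) = repH sigma (f v)].

(* Unitarity with respect to the compact form su(2): e^* = f and h^* = h. *)
Definition sl2_unitary (C : numClosedFieldType) (V : lmodType C)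
    (rho : sl2rep V) (ip : {dot V for conjC}) : Prop :=
  (forall v w, ip (repE rho v) w = ip v (repF rho w)) /\
  (forall v w, ip (repH rho v) w = ip v (repH rho w)).

(* The (2k+1)-dimensional irreducible module M_(2k+1) = C^(2k+1), in an
   orthonormal basis of weight vectors u_0 (lowest weight), ..., u_(2k):
     e u_i = sqrt ((i + 1) (2k - i)) u_(i+1),   h u_i = (2 i - 2k) u_i. *)
Section Irreducible.
Variables (C : numClosedFieldType) (k : nat).

Definition irr := 'cV[C]_(k.*2.+1).

Definition irrE : 'M[C]_(k.*2.+1) := \matrix_(j, i)
  if j == i.+1 :> nat then sqrtC (i.+1 * (k.*2 - i))%:R else 0.
Definition irrF : 'M[C]_(k.*2.+1) := irrE^T.
Definition irrH : 'M[C]_(k.*2.+1) := \matrix_(j, i)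
  if j == i then (i.*2)%:R - (k.*2)%:R else 0.

Lemma irrEF : irrE *m irrF - irrF *m irrE = irrH.
Proof.
apply/matrixP => a b; rewrite !mxE.
have sqr i : sqrtC i%:R * sqrtC i%:R = i%:R :> C.
  by rewrite -expr2 sqrtCK.
have -> : \sum_j irrE a j * irrF j b =
    if a == b then (a * (k.*2.+1 - a))%:R else 0.
  case: (posnP a) => [a0|a_gt0].
    rewrite a0 mul0n if_same big1 // => i _.
    by rewrite !mxE a0 mul0r.
  have ltp : (a.-1 < k.*2.+1)%N by rewrite prednK // ltnW.
  rewrite (bigD1 (Ordinal ltp)) //= big1 => [|i ni]; last first.
    rewrite !mxE; case: eqP => [ai|]; last by rewrite mul0r.
    by case/eqP: ni; apply: val_inj; rewrite /= ai.
  rewrite !mxE /= prednK // eqxx addr0 eq_sym -val_eqE /=.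
  case: eqP => _; last by rewrite mulr0.
  rewrite sqr; congr (_ * _)%:R.
  by rewrite -[in RHS](prednK a_gt0) subSS.
have -> : \sum_j irrF a j * irrE j b =
    if a == b then (a.+1 * (k.*2 - a))%:R else 0.
  have [ak|ak] := ltnP a.+1 k.*2.+1.
    rewrite (bigD1 (Ordinal ak)) //= big1 => [|i ni]; last first.
      rewrite !mxE; case: eqP => [ai|]; last by rewrite mul0r.
      by case/eqP: ni; apply: val_inj.
    rewrite !mxE /= eqxx addr0 eqSS -val_eqE /=.
    by case: eqP => [<-|_]; rewrite ?sqr ?mulr0.
  rewrite ltnS in ak; rewrite (eqP (_ : k.*2 - a == 0)%N) ?subn_eq0 // muln0.
  rewrite if_same big1 // => i _; rewrite !mxE; case: eqP => [ai|]; last by rewrite mul0r.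
  by have := ltn_ord i; rewrite ai !ltnS ltnNge ak.
rewrite -val_eqE /=; case: eqP => [ab|_]; last by rewrite subr0.
have ak : (a <= k.*2)%N by rewrite -ltnS.
have -> : (k.*2)%:R = (k.*2 - a)%:R + a%:R :> C by rewrite -natrD subnK.
by rewrite -ab subSn // mulnS mulSn -[(nat_of_ord a).*2]addnn !natrD; ring.
Qed.

Lemma irrHE : irrH *m irrE - irrE *m irrH = 2%:R *: irrE.
Proof.
apply/matrixP => a b; rewrite !mxE.
rewrite (bigD1 a) //= big1 => [|i ni]; last by rewrite !mxE eq_sym (negPf ni) mul0r.
rewrite (bigD1 b) //= big1 => [|i ni]; last by rewrite !mxE (negPf ni) mulr0.
rewrite !mxE !eqxx; case: eqP => [->|_]; last by rewrite !(mulr0, mul0r) !addr0 subr0.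
by rewrite doubleS -addn2 natrD; ring.
Qed.

Lemma irrHF : irrH *m irrF - irrF *m irrH = - 2%:R *: irrF.
Proof.
have HT : irrH^T = irrH.
  by apply/matrixP => a b; rewrite !mxE eq_sym; case: eqP => [->|].
apply: trmx_inj; rewrite linearB linearZ /= !trmx_mul HT /irrF trmxK.
by rewrite scaleNr -irrHE opprB.
Qed.

Definition irr_rep : sl2rep irr.
Proof.
refine (@Sl2Rep C irr (mulmx irrE) (mulmx irrF) (mulmx irrH) _ _ _) => v /=.
- by rewrite !mulmxA -mulmxBl irrEF.
- by rewrite !mulmxA -mulmxBl irrHE scalemxAl.
- by rewrite !mulmxA -mulmxBl irrHF scalemxAl.
Defined.

End Irreducible.

(* The multiplicity space M_k = Hom_(sl_2) (M_(2k+1), V) of M_(2k+1) in V. *)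
Definition mult (C : numClosedFieldType) (V : lmodType C) (rho : sl2rep V)
  (k : nat) : set {linear irr C k -> V} :=
  [set psi | sl2_hom (irr_rep C k) rho psi].

Section Fusion.
Variables (C : numClosedFieldType) (N : nat) (z : 'I_N -> C).

(* (C^2)^(tensor N): an element is given by its coordinates in the basis
   v_(s 0) (x) ... (x) v_(s (N-1)), where s : {ffun 'I_N -> 'I_2} and v_0, v_1
   are the lowest and highest weight vectors of C^2. *)
Definition tpow := {ffun {ffun 'I_N -> 'I_2} -> C^o}.

HB.instance Definition _ := Vector.on tpow.

Definition update (s : {ffun 'I_N -> 'I_2}) j b : {ffun 'I_N -> 'I_2} :=
  [ffun i => if i == j then b else s i].

(* x acting on the j-th tensor factor. *)
Definition site (x : 'M[C]_2) (j : 'I_N) (v : tpow) : tpow :=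
  [ffun s : {ffun 'I_N -> 'I_2} => \sum_b x (s j) b * v (update s j b)].

(* x (x) t^i acting on rho(z_1) (x) ... (x) rho(z_N). *)
Definition cur (x : 'M[C]_2) (i : nat) (v : tpow) : tpow :=
  \sum_j z j ^+ i *: site x j v.

(* sl_2 acting on C^2, in the basis v_0, v_1. *)
Definition sl2e : 'M[C]_2 := delta_mx 1 0.
Definition sl2f : 'M[C]_2 := delta_mx 0 1.
Definition sl2h : 'M[C]_2 := delta_mx 1 1 - delta_mx 0 0.

Definition vac : tpow := [ffun s => (s == [ffun=> 0])%:R].

(* e_(i_1) ... e_(i_l) (v_0 (x) ... (x) v_0) *)
Definition word (s : seq nat) : tpow := foldr (cur sl2e) vac s.

Definition Vdeg (m : nat) : {vspace tpow} :=
  spanset [set v | exists2 s : seq nat, sumn s = m & v = word s].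

(* Vlt m is V_N^(<= m - 1), that is the sum of the V_N^(j) for j < m. *)
Definition Vlt (m : nat) : {vspace tpow} := (\sum_(j < m) Vdeg j)%VS.

Definition gr (m : nat) : lmodType C := qmod (Vlt m.+1) (Vlt m).

Definition fusion := dsum gr.
HB.instance Definition _ := GRing.Lmodule.on fusion.

Definition fusion_deg (m : nat) (v : fusion) : Prop := dsum_deg m v.

Fact site_linear x j : linear (site x j).
Proof.
move=> a v w; apply/ffunP => s; rewrite !ffunE scaler_sumr -big_split /=.
apply: eq_bigr => b _; rewrite !ffunE mulrDr; congr (_ + _); exact: mulrCA.
Qed.
HB.instance Definition _ x j := GRing.isLinear.Build C tpow tpow _ (site x j)
  (site_linear x j).

Fact cur_linear x i : linear (cur x i).
Proof.
move=> a v w; rewrite /cur scaler_sumr -big_split /=; apply: eq_bigr => j _.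
by rewrite linearP scalerDr !scalerA mulrC.
Qed.
HB.instance Definition _ x i := GRing.isLinear.Build C tpow tpow _ (cur x i)
  (cur_linear x i).

Lemma site_mul x y j v : site x j (site y j v) = site (x *m y) j v.
Proof.
apply/ffunP => s; rewrite !ffunE.
under eq_bigr do rewrite ffunE mulr_sumr.
rewrite exchange_big /=; apply: eq_bigr => b _; rewrite mxE mulr_suml.
apply: eq_bigr => a _; rewrite mulrA !ffunE eqxx; congr (_ * v _).
by apply/ffunP => i; rewrite !ffunE; case: eqP.
Qed.

Lemma site_comm x y i j v : i != j ->
  site x i (site y j v) = site y j (site x i v).
Proof.
move=> ij; apply/ffunP => s; rewrite !ffunE.
under eq_bigr do rewrite ffunE mulr_sumr.
under [RHS]eq_bigr do rewrite ffunE mulr_sumr.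
rewrite exchange_big /=; apply: eq_bigr => b _; apply: eq_bigr => a _.
rewrite !ffunE (negPf ij) eq_sym (negPf ij) mulrCA; congr (_ * (_ * v _)).
apply/ffunP => l; rewrite !ffunE; case: (eqVneq l i) => [->|//].
by rewrite (negPf ij).
Qed.

Lemma site_sub x y j v : site (x - y) j v = site x j v - site y j v.
Proof.
apply/ffunP => s; rewrite !ffunE -sumrB; apply: eq_bigr => b _.
by rewrite !mxE mulrBl.
Qed.

Lemma cur_comm x y a b v :
  cur x a (cur y b v) - cur y b (cur x a v) = cur (x *m y - y *m x) (a + b) v.
Proof.
rewrite /cur; under eq_bigr do rewrite linear_sum scaler_sumr.
under [X in _ - X]eq_bigr do rewrite linear_sum scaler_sumr.
rewrite [X in _ - X]exchange_big -sumrB; apply: eq_bigr => j _ /=.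
rewrite -sumrB (bigD1 j) //= big1 ?addr0 => [|i ij]; last first.
  rewrite !linearZ /= !scalerA mulrC site_comm 1?eq_sym //.
  by rewrite -scalerDr subrr scaler0.
rewrite !linearZ /= !site_mul !scalerA [z j ^+ b * _]mulrC -exprD.
by rewrite -scalerDr site_sub.
Qed.

Lemma Vdeg_word s : word s \in Vdeg (sumn s).
Proof. by apply: spanset_sub; exists s. Qed.

Lemma VltS m d : (m <= d)%N -> (Vlt m <= Vlt d)%VS.
Proof.
move=> md; apply/subv_sumP => j _.
exact: (sumv_sup (widen_ord md j)).
Qed.

Lemma Vlt_deg j m : (j < m)%N -> (Vdeg j <= Vlt m)%VS.
Proof. by move=> jm; apply: (sumv_sup (Ordinal jm)). Qed.

Lemma Vlt_word s m : (sumn s < m)%N -> word s \in Vlt m.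
Proof. by move=> sm; apply/(subvP (Vlt_deg sm))/Vdeg_word. Qed.

Lemma Vlt_lin (A : {linear tpow -> tpow}) m (U : {vspace tpow}) :
  (forall s, (sumn s < m)%N -> A (word s) \in U) ->
  forall v, v \in Vlt m -> A v \in U.
Proof.
move=> AU v vm; have : (Vlt m <= linfun A @^-1: U)%VS.
  apply/subv_sumP => j _; apply: spanset_min => _ [s sj ->].
  by rewrite -memv_preim lfunE /=; apply: AU; rewrite sj.
by move/subvP => /(_ v vm); rewrite -memv_preim lfunE.
Qed.

Lemma Vlt_e i m v : v \in Vlt m -> cur sl2e i v \in Vlt (i + m).
Proof.
move: v; apply: Vlt_lin => s sm; apply: (@Vlt_word (i :: s)).
by rewrite /= ltn_add2l.
Qed.

Lemma site_vac x j : site x j vac = x 0 0 *: vac + x 1 0 *: site sl2e j vac.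
Proof.
apply/ffunP => s; rewrite !ffunE !big_ord_recl !big_ord0 !ffunE !mxE /=.
have upd b : (update s j b == [ffun=> 0]) =
             (b == 0) && (update s j 0 == [ffun=> 0]).
  case: (eqVneq b 0) => [->//|b0] /=; apply/negP => /eqP/ffunP/(_ j).
  by rewrite !ffunE eqxx => /eqP; rewrite (negPf b0).
have sE : (s == [ffun=> 0]) = (s j == 0) && (update s j 0 == [ffun=> 0]).
  rewrite -(upd (s j)); congr (_ == _); apply/ffunP => i.
  by rewrite !ffunE; case: eqP => [->|].
have -> : lift ord0 ord0 = 1 :> 'I_2 by apply: val_inj.
have -> : ord0 = 0 :> 'I_2 by [].
rewrite sE [update s j 1 == _]upd /= !mulr0 !addr0.
have /orP[/eqP->|/eqP->] : (s j == 0) || (s j == 1).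
  by case: (s j) => [[|[]]].
- by rewrite /= mul0r [_ *: 0]mulr0 addr0.
- by rewrite /= [_ *: 0]mulr0 add0r mul1r.
Qed.

Lemma cur_vac x a :
  cur x a vac = (x 0 0 * \sum_j z j ^+ a) *: vac + x 1 0 *: cur sl2e a vac.
Proof.
rewrite /cur mulr_sumr scaler_suml scaler_sumr -big_split /=.
apply: eq_bigr => j _; rewrite site_vac scalerDr !scalerA.
by rewrite [x 0 0 * _]mulrC [x 1 0 * _]mulrC.
Qed.

Lemma Vlt_cur x a m v : v \in Vlt m -> cur x a v \in Vlt (a + m).
Proof.
have wordP s y b : cur y b (word s) \in Vlt (b + sumn s).+1.
  elim: s y b => [|i s IHs] y b.
    rewrite cur_vac memvD // memvZ //.
      by apply: (@Vlt_word [::]).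
    by apply: (@Vlt_word [:: b]).
  rewrite -[cur y b _](subrK (cur sl2e i (cur y b (word s)))) cur_comm.
  rewrite memvD //.
    by rewrite /= addnA; apply: IHs.
  by rewrite /= addnCA -addnS; apply: Vlt_e.
move: v; apply: Vlt_lin => s sm; apply: (subvP _ _ (wordP s x a)).
by apply: VltS; rewrite -addnS leq_add2l.
Qed.

Fact Vlt_stable x m : (linfun (cur x 0) @: Vlt m <= Vlt m)%VS.
Proof. by apply/subvP => _ /memv_imgP[v vm ->]; rewrite lfunE; apply: Vlt_cur. Qed.

Definition gr_act x (m : nat) : {linear gr m -> gr m} :=
  qmap (Vlt_stable x m.+1) (Vlt_stable x m).

(* The action of x = x (x) 1 on V_N^*. *)
Definition fusion_act x : {linear fusion -> fusion} := dsum_map (gr_act x).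

Lemma gr_actE x m (u : subvs_of (Vlt m.+1)) :
  gr_act x m (qpi _ u) = qpi _ (vsproj _ (cur x 0 (vsval u))).
Proof. by rewrite [LHS]qmap_pi lfunE. Qed.

Lemma fusion_comm x y v :
  fusion_act x (fusion_act y v) - fusion_act y (fusion_act x v) =
  fusion_act (x *m y - y *m x) v.
Proof.
apply: dsumP => m; rewrite dsumDE dsumNE /=.
have [u ->] := qpi_surj (v m); rewrite (gr_actE x u) (gr_actE y u).
rewrite (gr_actE x (vsproj _ (cur y 0 _))) (gr_actE y (vsproj _ (cur x 0 _))).
rewrite gr_actE -linearB; congr qpi.
have st w : vsval (vsproj (Vlt m.+1) (cur w 0 (vsval u))) = cur w 0 (vsval u).
  by rewrite vsprojK // Vlt_cur // subvsP.
by rewrite -linearB !st /= cur_comm.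
Qed.

Lemma fusion_actZ c x v : fusion_act (c *: x) v = c *: fusion_act x v.
Proof.
apply: dsumP => m; rewrite dsumZE /=; have [u ->] := qpi_surj (v m).
rewrite (gr_actE x u) (gr_actE (c *: x) u) -linearZ -linearZ; congr (qpi _ (vsproj _ _)).
rewrite /cur scaler_sumr; apply: eq_bigr => j _; rewrite scalerA mulrC -scalerA.
congr (_ *: _); apply/ffunP => s; rewrite !ffunE scaler_sumr.
by apply: eq_bigr => b _; rewrite mxE -mulrA.
Qed.

Definition fusion_rep : sl2rep fusion.
Proof.
refine (@Sl2Rep C fusion (fusion_act sl2e) (fusion_act sl2f) (fusion_act sl2h)
  _ _ _) => v; rewrite fusion_comm -?fusion_actZ; congr (fusion_act _ v);
  apply/matrixP => a b; rewrite !mxE !big_ord_recl !big_ord0 !mxE;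
  by case: a => [[|[]]] //= ?; case: b => [[|[]]] //= ?; ring.
Defined.

End Fusion.

Section Tableaux.
Variables (lam : seq nat) (N : nat).

(* The cells of the Young diagram lam, row 0 being the topmost one. *)
Definition cell : finType := {r : 'I_(size lam) & 'I_(nth 0%N lam r)}.
Definition crow (c : cell) : nat := tag c.
Definition ccol (c : cell) : nat := tagged c.

(* The entry of the cell c is (t c).+1, so that entries range over 1, ..., N. *)
Definition standard (t : {ffun cell -> 'I_N}) : bool :=
  [&& injectiveb t, [forall i, i \in codom t],
      [forall c, forall d, (crow c == crow d) && (ccol c < ccol d)%N
        ==> (t c < t d)%N]
    & [forall c, forall d, (ccol c == ccol d) && (crow c < crow d)%N
        ==> (t c < t d)%N]].

Record syt := Syt { syt_fun :> {ffun cell -> 'I_N}; _ : standard syt_fun }.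
HB.instance Definition _ := [isSub for syt_fun].
HB.instance Definition _ := [Finite of syt by <:].

Definition entry (t : syt) (c : cell) : nat := (t c).+1.

Definition descent (t : syt) (i : nat) : bool :=
  [exists c, exists d, [&& entry t c == i, entry t d == i.+1
                         & (crow c < crow d)%N]].

Definition maj (t : syt) : nat := \sum_(1 <= i < N | descent t i) i.

End Tableaux.

Section XSpace.
Variables (C : numClosedFieldType) (n : nat).

Definition tab (k : nat) : finType := syt [:: n + k; n - k]%N n.*2.

(* X_N = (+)_k M_(2k+1) (x) H_(pi_k), where H_(pi_k) has the tableaux of shape
   (n + k, n - k) as an orthonormal basis: an element is given by its
   coordinates in the orthonormal basis of the vectors u_j (x) tau. *)
Definition xidx : finType := {k : 'I_n.+1 & (tab k * 'I_(k.*2.+1))%type}.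
Definition XN := {ffun xidx -> C^o}.
HB.instance Definition _ := Vector.on XN.

Definition xin (k : 'I_n.+1) (t : tab k) (j : 'I_(k.*2.+1)) : xidx :=
  existT _ k (t, j).

Definition xvec (x : xidx) : XN := [ffun y => (y == x)%:R].

(* u (x) t in the k-th summand *)
Definition xtens (k : 'I_n.+1) (u : irr C k) (t : tab k) : XN :=
  \sum_j u j 0 *: xvec (xin t j).

Definition XN_deg (m : nat) (v : XN) : Prop :=
  forall (k : 'I_n.+1) (t : tab k) j, maj t != m -> v (xin t j) = 0.

Definition xact (A : forall k, 'M[C]_(k.*2.+1)) (v : XN) : XN :=
  [ffun x : xidx =>
    \sum_i A (tag x) (tagged x).2 i * v (xin (tagged x).1 i)].

Fact xact_linear A : linear (xact A).
Proof.
move=> a v w; apply/ffunP => x; rewrite !ffunE scaler_sumr -big_split /=.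
apply: eq_bigr => i _; rewrite !ffunE mulrDr; congr (_ + _); exact: mulrCA.
Qed.
HB.instance Definition _ A := GRing.isLinear.Build C XN XN _ (xact A) (xact_linear A).

Lemma xact_comm (A B D : forall k, 'M[C]_(k.*2.+1)) c v :
  (forall k, A k *m B k - B k *m A k = c *: D k) ->
  xact A (xact B v) - xact B (xact A v) = c *: xact D v.
Proof.
move=> ABD; apply/ffunP => -[k [t j]]; rewrite !ffunE /=.
have mulE (F G : forall k, 'M[C]_(k.*2.+1)) :
    \sum_i F k j i * xact G v (xin t i) = \sum_i (F k *m G k) j i * v (xin t i).
  under eq_bigr do rewrite ffunE /= mulr_sumr.
  rewrite exchange_big; apply: eq_bigr => i _; rewrite mxE mulr_suml.
  by apply: eq_bigr => l _; rewrite mulrA.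
rewrite !mulE -sumrB scaler_sumr; apply: eq_bigr => i _.
have /matrixP/(_ j i) := ABD k; rewrite !mxE => E.
by rewrite -mulrBl E -mulrA.
Qed.

Definition XN_rep : sl2rep XN.
Proof.
refine (@Sl2Rep C XN (xact (irrE C)) (xact (irrF C)) (xact (irrH C)) _ _ _) => v.
- by rewrite /= (@xact_comm _ _ (irrH C) 1) ?scale1r // => k; rewrite irrEF scale1r.
- by rewrite /= (@xact_comm _ _ (irrE C) 2%:R) // => k; rewrite irrHE.
- by rewrite /= (@xact_comm _ _ (irrF C) (- 2%:R)) // => k; rewrite irrHF.
Defined.

Definition xdot (v w : XN) : C := \sum_x v x * (w x)^*.

Fact xdot_bilinear : bilinear_for *%R (conjC \; *%R) xdot.
Proof.
split=> [w a u v|v a u w]; rewrite /xdot /= mulr_sumr -big_split;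
  apply: eq_bigr => x _; rewrite !ffunE /=.
- by rewrite mulrDl mulrA.
- by rewrite rmorphD rmorphM mulrDr mulrCA.
Qed.
HB.instance Definition _ := bilinear_isBilinear.Build C XN XN C
  *%R (conjC \; *%R) xdot xdot_bilinear.

Fact xdot_hermitian v w : xdot v w = (-1) ^+ false * (xdot w v)^*.
Proof.
rewrite mul1r rmorph_sum; apply: eq_bigr => x _.
by rewrite rmorphM /= conjCK mulrC.
Qed.
HB.instance Definition _ := isHermitianSesquilinear.Build C XN false conjC
  xdot xdot_hermitian.

Fact xdot_gt0 v : v != 0 -> 0 < xdot v v.
Proof.
move=> v0; have ge0 x : 0 <= v x * (v x)^* by rewrite mul_conjC_ge0.
rewrite lt_def sumr_ge0 ?andbT // psumr_eq0 //.
apply: contra v0 => /allP v0; apply/eqP/ffunP => x; rewrite ffunE.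
by have := v0 x (mem_index_enum x); rewrite mul_conjC_eq0 => /eqP.
Qed.
HB.instance Definition _ := isDotProduct.Build C XN xdot xdot_gt0.

End XSpace.

(* Main.v *)
From HB Require Import structures.
Require Import Defs.
From mathcomp Require Import all_boot all_order all_fingroup all_algebra.
From mathcomp Require Import generic_quotient.
From mathcomp Require Import boolp classical_sets reals complex.
From mathcomp Require Import ring zify.

(** Weight l of the N-th tensor power of C^2 (l spins up, N = 2n) is the space of
    functions on the l-element subsets of the set Z of the z_j, and
    e_(i_1) ... e_(i_l) vac is the function that symmetrises the monomial
    x_1^(i_1) ... x_l^(i_l).  The words of degree less than m span in weight l a space
    whose dimension is the number of partitions of size less than m with at most l
    parts, all at most N - l:
    - a polynomial of degree at most N - l in each of l variables that vanishes on
      all tuples of distinct points of Z is zero, so the words indexed by these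
      partitions are independent (words_free);
    - multiplication by the Vandermonde determinant is injective on weight l and
      turns a word into a sum of alternants det (x_j^(nu_i)).  The points of Z are the
      roots of a polynomial of degree N, so an exponent nu_i >= N can be lowered, and
      an alternant with distinct exponents below N is, up to sign, the one of a
      partition plus (l - 1, ..., 0) (alternant_span).
    Hence the graded dimension of weight l of the fusion product is the Gaussian
    binomial [N, l].

    The major indices of the tableaux of shape (N - l, l) have generating polynomial
    [N, l] - [N, l - 1].  Such tableaux are ballot words, their descents are the
    patterns 01, and removing the last letter gives for ballot words the recursion
    that Gaussian binomials satisfy as well (ballot_genE).

    With l = n - k, the operator f maps degree m of weight l to degree m of weight
    l - 1, so its kernel, which consists of lowest weight vectors of M_(2k+1), has
    dimension at least the number of tableaux of shape (n + k, n - k) and major index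
    m.  Choose in it orthonormal vectors b_t indexed by these tableaux
    (lowest_basis); orthogonality for different m or different k comes from the
    hypotheses on the inner product.  By unitarity each b_t generates a copy of
    M_(2k+1) on which the normalised vectors e^j b_t are orthonormal and transform
    like the basis u_j.  So u_j (x) t |-> e^j b_t / norm is an isometric
    graded homomorphism from the tableau space to the fusion product; it is onto
    because both have dimension 2^N: the sum of (2k + 1) times the number of tableaux
    telescopes to the sum of the binomials.  Phi is its inverse.  The description of
    the multiplicity spaces is then Schur's lemma in the tableau space (hom_XN). *)

Set Implicit Arguments.
Unset Strict Implicit.
Unset Printing Implicit Defensive.

Import Order.TTheory GRing.Theory Num.Theory Num.Def.
Local Open Scope ring_scope.

(** * Gaussian binomial coefficients *)

Fixpoint qbin (p b : nat) : {poly int} :=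
  match p, b with
  | _, 0%N => 1
  | 0%N, _.+1 => 0
  | p'.+1, b'.+1 => qbin p' b' + 'X^(b'.+1) * qbin p' b'.+1
  end.

Lemma qbin0 p : qbin p 0 = 1. Proof. by case: p. Qed.

Lemma qbinS p b : qbin p.+1 b.+1 = qbin p b + 'X^(b.+1) * qbin p b.+1.
Proof. by []. Qed.

Lemma qbin_small p b : (p < b)%N -> qbin p b = 0.
Proof.
elim: p b => [|p IHp] [|b] //= pb.
by rewrite !IHp ?mulr0 ?addr0 //; lia.
Qed.

Lemma qbinn p : qbin p p = 1.
Proof. by elim: p => //= p ->; rewrite qbin_small // mulr0 addr0. Qed.

(** The second Pascal rule, from the first one by induction. *)
Lemma qbinSr p b : (b <= p)%N ->
  qbin p.+1 b.+1 = 'X^(p - b) * qbin p b + qbin p b.+1.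
Proof.
elim: p b => [|p IHp] b bp.
  by move: bp; rewrite leqn0 => /eqP->; rewrite /= expr0; ring.
case: b bp => [|b] bp.
  rewrite [LHS]qbinS {1}(IHp 0%N) // (qbinS p 0) !qbin0 !subn0 !exprS; ring.
rewrite qbinS subSS.
have [->|pb] := eqVneq b p.
  by rewrite subnn !qbinn !qbin_small // expr0; ring.
have bp' : (b < p)%N by rewrite ltn_neqAle pb.
rewrite [in LHS]IHp // [in LHS](IHp b.+1) // [in RHS](qbinS p b).
by rewrite [in RHS](qbinS p b.+1) -(subnSK bp') !exprS; ring.
Qed.

Lemma qbin_sym p b : (b <= p)%N -> qbin p (p - b) = qbin p b.
Proof.
elim: p b => [|p IHp] [|b] bp //; first by rewrite subn0 qbinn qbin0.
rewrite subSS [RHS]qbinS.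
have [->|pb] := eqVneq b p; first by rewrite subnn !qbin0 qbinn qbin_small // mulr0 addr0.
have {}bp : (b < p)%N by lia.
have -> : (p - b = (p - b.+1).+1)%N by lia.
rewrite qbinSr ?leq_subr // IHp // subnSK // IHp 1?ltnW // subKn //.
by rewrite addrC.
Qed.

(** Eliminating the powers of q that depend on b between the two Pascal rules
    leaves a recursion that treats both kinds of letters alike; the major index
    satisfies it as well. *)
Lemma qbin_rec p b :
  qbin p.+2 b.+1 = qbin p.+1 b.+1 + qbin p.+1 b + ('X^(p.+1) - 1) * qbin p b.
Proof.
suff H : ('X^(b.+1) - 1) * qbin p.+1 b.+1 = ('X^(p.+1) - 1) * qbin p b.
  by rewrite qbinS -H; ring.
have [bp|pb] := leqP b p; last by rewrite !qbin_small //; ring.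
have E := qbinSr bp; rewrite qbinS in E.
have {}E : ('X^(b.+1) - 1) * qbin p b.+1 = ('X^(p - b) - 1) * qbin p b.
  rewrite !mulrBl !mul1r; move/eqP: E; rewrite -subr_eq addrAC => /eqP <-.
  ring.
rewrite qbinS mulrDr [_ * ('X^_ * _)]mulrCA E.
have -> : 'X^(p.+1) = 'X^(b.+1) * 'X^(p - b) :> {poly int}.
  by rewrite -exprD; congr ('X^_); lia.
ring.
Qed.

Lemma qbin1 p b : (qbin p b).[1] = 'C(p, b)%:R.
Proof.
elim: p b => [|p IHp] [|b]; rewrite ?qbin0 ?bin0 ?hornerC //.
rewrite qbinS hornerD hornerM hornerXn !IHp expr1n mul1r binS natrD.
exact: addrC.
Qed.

(** * Partitions in a box *)

(** Partitions are decreasing lists padded with zeros to length b: in this form they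
    serve as exponent vectors. *)
Fixpoint boxes (a b : nat) {struct b} : seq (seq nat) :=
  if b is b'.+1 then
    (fix up_to a := if a is a'.+1 then [seq a :: s | s <- boxes a b'] ++ up_to a'
                    else [:: nseq b 0%N]) a
  else [:: [::]].

Lemma boxesS a b :
  boxes a.+1 b.+1 = [seq a.+1 :: s | s <- boxes a.+1 b] ++ boxes a b.+1.
Proof. by []. Qed.

Lemma mem_boxes a b s :
  (s \in boxes a b) = [&& size s == b, all (leq^~ a) s & sorted geq s].
Proof.
elim: b a s => [|b IHb] a s.
  by case: a => [|a]; case: s.
elim: a s => [|a IHa] s.
  rewrite /= inE; apply/eqP/and3P => [->|[/eqP sz s0 _]].
    split; first by rewrite /= size_nseq.
      by rewrite /= all_nseq orbT.
    by rewrite /=; elim: (b) => //= m ->.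
  have /all_pred1P -> : all (pred1 0%N) s.
    by apply: sub_all s0 => i /=; rewrite leqn0.
  by rewrite sz.
rewrite boxesS mem_cat {}IHa.
case: s => [|x s] /=.
  by rewrite orbF; apply/negbTE/mapP => -[].
rewrite eqSS (path_sortedE (rev_trans leq_trans)).
have -> : ((x :: s) \in [seq a.+1 :: s | s <- boxes a.+1 b]) =
          (x == a.+1) && (s \in boxes a.+1 b).
  apply/mapP/andP => [[t tb [-> ->]]|[/eqP-> sb]]; first by rewrite eqxx.
  by exists s.
rewrite IHb; case: (size s == b) => /=; last by rewrite andbF.
have H c d : (c <= d)%N -> all (geq c) s -> all (leq^~ d) s.
  by move=> cd; apply: sub_all => i /= /leq_trans->.
have [xa|ax] := leqP x a.
  rewrite (ltn_eqF (xa : (x < a.+1)%N)) (leqW xa) /=.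
  case E: (all (leq^~ x) s); last by rewrite !andbF.
  by rewrite (H x a) // (H x a.+1) // leqW.
rewrite orbF; have [->|xa] := eqVneq x a.+1; first by rewrite leqnn /=; case: (all _ _).
by rewrite leqNgt ltn_neqAle eq_sym xa ax.
Qed.

Lemma boxes_uniq a b : uniq (boxes a b).
Proof.
elim: b a => [|b IHb] a; first by case: a.
elim: a => [|a IHa] //; rewrite boxesS cat_uniq map_inj_uniq ?IHb ?IHa; last by move=> ? ? [].
rewrite andbT; apply/hasPn => s; rewrite mem_boxes => /and3P[_ sa _].
by apply/mapP => -[t _ st]; move: sa; rewrite st /= ltnn.
Qed.

(** The two pieces of the recursive definition (largest part a, or less) are the two
    terms of qbinSr. *)
Lemma boxes_gen a b : \sum_(s <- boxes a b) 'X^(sumn s) = qbin (a + b) b.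
Proof.
elim: b a => [|b IHb] a.
  by rewrite qbin0; case: a => [|a]; rewrite /= big_seq1.
elim: a => [|a IHa].
  rewrite add0n qbinn /= big_seq1 -[RHS](expr0 'X); congr ('X^_).
  by rewrite /= sumn_nseq mul0n.
rewrite boxesS big_cat big_map IHa addSn addnS [RHS]qbinSr; last by lia.
rewrite -(addSn a b) addnK -IHb mulr_sumr; congr (_ + _).
by apply: eq_bigr => s _; rewrite /= exprD.
Qed.

(** * The major index of ballot words *)

Fixpoint bit_words (p : nat) : seq (seq bool) :=
  if p is p'.+1 then [seq false :: w | w <- bit_words p'] ++ [seq true :: w | w <- bit_words p']
  else [:: [::]].

(** A word lists its letters from the last to the first, so that its tails are the
    prefixes of the tableau: the letter at position i tells the row of the entry i + 1. *)
Fixpoint ballot (w : seq bool) : bool :=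
  if w is x :: w' then ballot w' && (count id w <= count negb w)%N else true.

(** The default value true of head makes the first letter no descent. *)
Fixpoint majw (w : seq bool) : nat :=
  if w is x :: w' then (majw w' + (if x && ~~ head true w' then size w' else 0))%N
  else 0%N.

Definition ballots (p b : nat) : seq (seq bool) :=
  [seq w <- bit_words p | ballot w && (count id w == b)].

Definition ballot_gen (p b : nat) : {poly int} := \sum_(w <- ballots p b) 'X^(majw w).

Lemma bit_wordsS p :
  bit_words p.+1 = [seq false :: w | w <- bit_words p] ++ [seq true :: w | w <- bit_words p].
Proof. by []. Qed.

Lemma mem_bit_words p w : (w \in bit_words p) = (size w == p).
Proof.
elim: p w => [|p IHp] [|x w] //=.
  by rewrite mem_cat; apply/negbTE/negP => /orP[] /mapP[].
rewrite mem_cat eqSS -IHp; apply/orP/idP => [[] /mapP[v vp [_ ->]]//|wp].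
by case: x; [right|left]; apply/mapP; exists w.
Qed.

Lemma bit_words_uniq p : uniq (bit_words p).
Proof.
elim: p => //= p IHp; rewrite cat_uniq !map_inj_uniq ?IHp /=; try by move=> ? ? [].
by rewrite andbT; apply/hasPn => w /mapP[v _ ->]; apply/mapP => -[].
Qed.

Lemma ballots_uniq p b : uniq (ballots p b).
Proof. exact/filter_uniq/bit_words_uniq. Qed.

Lemma mem_ballots p b w :
  (w \in ballots p b) = [&& ballot w, count id w == b & size w == p].
Proof. by rewrite mem_filter mem_bit_words andbA. Qed.

Lemma count_negb (w : seq bool) : (count id w + count negb w)%N = size w.
Proof. exact: (count_predC id). Qed.

Lemma ballot_count w : ballot w -> (count id w <= count negb w)%N.
Proof. by case: w => [|x w] //= /andP[]. Qed.

Lemma ballot_gen_small p b : (p < b.*2)%N -> ballot_gen p b = 0.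
Proof.
move=> pb; rewrite /ballot_gen big1_seq // => w /=.
rewrite mem_ballots => /and3P[/ballot_count + /eqP cb /eqP sz].
by move=> + ; have := count_negb w; rewrite cb sz; lia.
Qed.

(** The word without ones has no descent. *)
Lemma ballot_gen0 p : ballot_gen p 0 = 1.
Proof.
have E : ballots p 0 =i [:: nseq p false].
  move=> w; rewrite mem_ballots inE; apply/and3P/eqP => [[_ + /eqP<-]|->].
    by elim: w => // -[|] w IHw //= /IHw {1}->.
  have C q : count id (nseq q false) = 0%N by rewrite count_nseq.
  rewrite C size_nseq; split => //.
  by elim: p => //= p ->; rewrite C.
rewrite /ballot_gen (perm_big [:: nseq p false]) /=; last by rewrite uniq_perm ?ballots_uniq.
by rewrite big_seq1 -[RHS](expr0 'X); congr ('X^_); elim: p {E} => //= p ->.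
Qed.

(** Remove the last letter; if it is a one, its contribution depends on the letter
    before it. *)
Lemma ballot_gen_rec p b : (b.+1.*2 <= p.+2)%N ->
  ballot_gen p.+2 b.+1 = ballot_gen p.+1 b.+1 + ballot_gen p.+1 b + ('X^(p.+1) - 1) * ballot_gen p b.
Proof.
move=> bp; rewrite /ballot_gen /ballots !big_filter bit_wordsS big_cat !big_map -addrA.
have F q c : \sum_(w <- bit_words q | ballot (false :: w) && (count id (false :: w) == c))
    'X^(majw (false :: w)) = ballot_gen q c.
  rewrite /ballot_gen big_filter; apply: eq_big => [w|w _] /=; last by rewrite addn0.
  rewrite add0n add1n; case B: (ballot w) => //=.
  by rewrite (leq_trans (ballot_count B)).
congr (_ + _); first by rewrite F /ballot_gen big_filter.
transitivity (\sum_(w <- bit_words p.+1 | ballot w && (count id w == b))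
    ('X^(majw w) + (if ~~ head true w then ('X^(p.+1) - 1) * 'X^(majw w) else 0)) : {poly int}).
  rewrite big_seq_cond [RHS]big_seq_cond; apply: eq_big => [w|w].
    rewrite mem_bit_words; case: eqP => //= sz; rewrite add1n add0n eqSS -andbA; congr (_ && _).
    by have := count_negb w; lia.
  rewrite mem_bit_words => /andP[/eqP sz _]; rewrite /= sz exprD.
  by case: (head _ _); rewrite /= ?expr0; ring.
rewrite big_split; congr (_ + _).
rewrite -big_mkcondr bit_wordsS big_cat !big_map [X in _ + X = _]big_pred0 ?addr0; last first.
  by move=> w; rewrite /= !andbF.
have := F p b; rewrite /ballot_gen big_filter => <-; rewrite mulr_sumr.
by apply: eq_bigl => w; rewrite andbT.
Qed.

(** Both sides obey the recursion of qbin_rec; on the line 2b = p + 1, just outside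
    the range of ballot words, the right-hand side vanishes by symmetry. *)
Lemma ballot_genE p b : (b.*2 <= p.+1)%N ->
  ballot_gen p b = qbin p b - (if b is b'.+1 then qbin p b' else 0).
Proof.
elim/ltn_ind: p b => p IHp [|b] bp; first by rewrite ballot_gen0 qbin0 subr0.
(* the line 2b = p + 1, for b.+1 *)
have [pb|pb] := ltnP p b.+1.*2.
  rewrite ballot_gen_small // -(@qbin_sym p b); last by lia.
  have -> : (p - b = b.+1)%N by lia.
  exact/esym/subrr.
case: p => [|[|p]] in IHp bp pb *; try by exfalso; lia.
rewrite ballot_gen_rec // !IHp //; try by lia.
rewrite qbin_rec; case: b => [|b] in bp pb *; first by rewrite !qbin0; ring.
by rewrite (qbin_rec p b); ring.
Qed.

(** * Two-row standard tableaux and ballot words *)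

Definition bits_of (f : nat -> bool) (p : nat) : seq bool :=
  [seq f i | i <- rev (iota 0 p)].

Lemma bits_ofS f p : bits_of f p.+1 = f p :: bits_of f p.
Proof. by rewrite /bits_of -addn1 iotaD rev_cat. Qed.

Lemma size_bits_of f p : size (bits_of f p) = p.
Proof. by rewrite size_map size_rev size_iota. Qed.

Lemma count_bits_of f (x : pred bool) p : count x (bits_of f p) = count (preim f x) (iota 0 p).
Proof. by rewrite count_map count_rev. Qed.

Lemma ballot_bits_of f p : reflect
  (forall q, (q <= p)%N -> (count f (iota 0 q) <= count (predC f) (iota 0 q))%N)
  (ballot (bits_of f p)).
Proof.
elim: p => [|p IHp]; first by constructor => -[].
rewrite bits_ofS /ballot -/ballot -(bits_ofS f p) !count_bits_of.
apply: (iffP andP) => [[/IHp Hp Hp1] q|H].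
  by rewrite leq_eqVlt => /orP[/eqP->//|]; apply: Hp.
by split; [apply/IHp => q qp; apply/H/leqW | apply: H].
Qed.

Lemma majw_bits_of f p : majw (bits_of f p) = \sum_(1 <= i < p | f i && ~~ f i.-1) i.
Proof.
elim: p => [|[|p] IHp]; first by rewrite big_geq.
  by rewrite big_geq //= andbF.
rewrite bits_ofS /majw -/majw IHp size_bits_of big_mkcond [RHS]big_mkcond /=.
by rewrite [RHS]big_nat_recr // bits_ofS.
Qed.

(** The word of a tableau determines the tableau: the c-th cell of a row holds the
    position of the c-th occurrence of the letter of that row. *)
Definition positions (f : pred nat) (p : nat) : seq nat := [seq i <- iota 0 p | f i].

Lemma positions_sorted f p : sorted ltn (positions f p).
Proof. exact/(sorted_filter ltn_trans)/iota_ltn_sorted. Qed.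

Lemma count_iotaS f p : count f (iota 0 p.+1) = (count f (iota 0 p) + f p)%N.
Proof. by rewrite -addn1 iotaD count_cat /= addn0. Qed.

Lemma leq_count_iota f p q : (p <= q)%N ->
  (count f (iota 0 p) <= count f (iota 0 q))%N.
Proof. by move=> pq; rewrite -(subnKC pq) iotaD count_cat leq_addr. Qed.

Lemma nth_positions f p c : (c < size (positions f p))%N ->
  let i := nth 0%N (positions f p) c in
  [/\ f i, (i < p)%N & count f (iota 0 i) = c].
Proof.
move=> cs i; have : i \in positions f p by rewrite mem_nth.
rewrite mem_filter mem_iota add0n => /andP[fi /andP[_ ip]]; split => //.
have us : uniq (positions f p) by rewrite filter_uniq ?iota_uniq.
have E : positions f p = positions f i ++ i :: [seq j <- iota i.+1 (p - i.+1) | f j].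
  have {1}-> : p = (i + (p - i.+1).+1)%N by lia.
  by rewrite /positions iotaD filter_cat /= add0n fi.
rewrite -[RHS](index_uniq 0%N cs us) -/i E index_cat mem_filter mem_iota ltnn !andbF.
by rewrite /= eqxx addn0 size_filter.
Qed.

Lemma positions_lt f p c d : (c < d)%N -> (d < size (positions f p))%N ->
  (nth 0%N (positions f p) c < nth 0%N (positions f p) d)%N.
Proof.
move=> cd ds; have [_ _ Ec] := nth_positions (ltn_trans cd ds); have [_ _ Ed] := nth_positions ds.
by rewrite ltnNge; apply/negP => /(leq_count_iota f); rewrite Ec Ed leqNgt cd.
Qed.

Section TwoRows.
Variables (a b : nat).
Hypothesis ba : (b <= a)%N.
Let N := (a + b)%N.
Let lam := [:: a; b].

Definition cell0 (c : 'I_a) : cell lam :=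
  existT (fun r : 'I_2 => 'I_(nth 0%N lam r)) (Ordinal (isT : 0 < 2)%N) c.
Definition cell1 (c : 'I_b) : cell lam :=
  existT (fun r : 'I_2 => 'I_(nth 0%N lam r)) (Ordinal (isT : 1 < 2)%N) c.

Lemma cell_ind2 (P : cell lam -> Prop) :
  (forall c, P (cell0 c)) -> (forall c, P (cell1 c)) -> forall c, P c.
Proof.
move=> P0 P1 [[[|[|m]] mlt] c] //.
- by rewrite (bool_irrelevance mlt isT) in c *; apply: P0.
- by rewrite (bool_irrelevance mlt isT) in c *; apply: P1.
Qed.

Definition row1 (t : {ffun cell lam -> 'I_N}) (i : nat) : bool :=
  [exists c, (t c == i :> nat) && (crow c == 1%N)].

Section Tableau.
Variable t : syt lam N.

Lemma syt_inj : injective t.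
Proof. by case: t => u /= /and4P[/injectiveP]. Qed.

Lemma syt_onto (i : 'I_N) : exists c, t c = i.
Proof.
by case: t => u /= /and4P[_ /forallP/(_ i)/codomP[c ->] _ _]; exists c.
Qed.

Lemma syt_row c d : crow c = crow d -> (ccol c < ccol d)%N -> (t c < t d)%N.
Proof.
case: t => u /= /and4P[_ _ /forallP/(_ c)/forallP/(_ d)/implyP H _] cd lt.
by apply: H; rewrite cd eqxx.
Qed.

Lemma syt_col c d : ccol c = ccol d -> (crow c < crow d)%N -> (t c < t d)%N.
Proof.
case: t => u /= /and4P[_ _ _ /forallP/(_ c)/forallP/(_ d)/implyP H] cd lt.
by apply: H; rewrite cd eqxx.
Qed.

Lemma row1_cell c : row1 t (t c) = (crow c == 1%N).
Proof.
apply/existsP/idP => [[d /andP[/eqP/val_inj/syt_inj->]]//|c1].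
by exists c; rewrite eqxx.
Qed.

Lemma row0P i : (i < N)%N -> ~~ row1 t i -> exists c, t (cell0 c) = i :> nat.
Proof.
move=> iN; have [c Ec] := syt_onto (Ordinal iN).
have -> : i = t c by rewrite Ec.
rewrite row1_cell; elim/cell_ind2: c {Ec} => c; last by [].
by exists c.
Qed.

Lemma row1P i : row1 t i -> exists c, t (cell1 c) = i :> nat.
Proof.
case/existsP => c /andP[/eqP<-]; elim/cell_ind2: c => c //; by exists c.
Qed.

Lemma enum_ord_ltn m : sorted (fun c d : 'I_m => (c < d)%N) (enum 'I_m).
Proof. by have := iota_ltn_sorted 0 m; rewrite -val_enum_ord sorted_map. Qed.

Lemma positions_row0 : positions (predC (row1 t)) N = [seq nat_of_ord (t (cell0 c)) | c <- enum 'I_a].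
Proof.
apply: (irr_sorted_eq ltn_trans ltnn (positions_sorted _ _)).
  rewrite sorted_map; apply: sub_sorted (enum_ord_ltn a) => c d cd.
  by apply: syt_row.
move=> i; rewrite mem_filter mem_iota add0n /=; apply/andP/mapP => [[fi iN]|[c _ ->]].
  by have [c <-] := row0P iN fi; exists c; rewrite ?mem_enum.
by rewrite row1_cell.
Qed.

Lemma positions_row1 : positions (row1 t) N = [seq nat_of_ord (t (cell1 c)) | c <- enum 'I_b].
Proof.
apply: (irr_sorted_eq ltn_trans ltnn (positions_sorted _ _)).
  rewrite sorted_map; apply: sub_sorted (enum_ord_ltn b) => c d cd.
  by apply: syt_row.
move=> i; rewrite mem_filter mem_iota add0n /=; apply/andP/mapP => [[fi iN]|[c _ ->]].
  by have [c <-] := row1P fi; exists c; rewrite ?mem_enum.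
by rewrite row1_cell.
Qed.

Lemma entry0 c : t (cell0 c) = nth 0%N (positions (predC (row1 t)) N) c :> nat.
Proof.
rewrite positions_row0 (nth_map c) ?size_enum_ord //; congr (nat_of_ord (t (cell0 _))).
by apply: val_inj; rewrite /= nth_enum_ord.
Qed.

Lemma entry1 c : t (cell1 c) = nth 0%N (positions (row1 t) N) c :> nat.
Proof.
rewrite positions_row1 (nth_map c) ?size_enum_ord //; congr (nat_of_ord (t (cell1 _))).
by apply: val_inj; rewrite /= nth_enum_ord.
Qed.

Lemma row1_count : count (row1 t) (iota 0 N) = b.
Proof. by rewrite -size_filter -/(positions _ _) positions_row1 size_map size_enum_ord. Qed.

Lemma count_positions f q : (q <= N)%N -> count f (iota 0 q) = count (fun i => i < q)%N (positions f N).
Proof.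
move=> qN; rewrite /positions count_filter -(subnKC qN) iotaD count_cat add0n.
rewrite [X in (_ + X)%N](_ : _ = 0%N).
  by rewrite addn0; apply: eq_in_count => i; rewrite mem_iota add0n /= => ->.
apply/eqP; rewrite -leqn0 leqNgt -has_count; apply/hasPn => i.
by rewrite mem_iota /= => /andP[qi _]; rewrite ltnNge qi.
Qed.

Lemma count_lt_ord m (g : 'I_m -> nat) q :
  count (fun i => i < q)%N [seq g c | c <- enum 'I_m] = #|[pred c | g c < q]%N|.
Proof. by rewrite -sum1_count big_map big_enum_cond -sum1_card; apply: eq_bigl. Qed.

(** To the c-th cell of the second row corresponds the cell above it, whose entry is
    smaller: every prefix has at least as many zeros as ones. *)
Lemma row1_ballot : ballot (bits_of (row1 t) N).
Proof.
apply/ballot_bits_of => q qN; rewrite !count_positions // positions_row0 positions_row1.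
rewrite !count_lt_ord -(card_image (f := widen_ord ba)); last first.
  by move=> c d /(congr1 val)/= /val_inj.
apply/subset_leq_card/fintype.subsetP => _ /fintype.imageP[c tc ->]; move: tc; rewrite !inE.
by apply: ltn_trans; apply: (@syt_col (cell0 _) (cell1 c)).
Qed.

Lemma descentE i : (0 < i < N)%N -> descent t i = row1 t i && ~~ row1 t i.-1.
Proof.
case: i => // i iN; rewrite [_.-1]/=.
apply/existsP/andP => [[c /existsP[d /and3P[]]]|[ri ri']].
  rewrite /entry eqSS => /eqP <- /eqP[<-] /=; rewrite !row1_cell.
  by elim/cell_ind2: c => c; elim/cell_ind2: d => d.
have [c tc] := row0P (ltnW iN) ri'; have [d td] := row1P ri.
by exists (cell0 c); apply/existsP; exists (cell1 d); rewrite /entry tc td !eqxx.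
Qed.

Lemma majE : maj t = majw (bits_of (row1 t) N).
Proof.
rewrite majw_bits_of /maj big_nat_cond [RHS]big_nat_cond; apply: eq_bigl => i.
by case E: (0 < i < N)%N => //=; apply: descentE.
Qed.

End Tableau.

Lemma row1_inj (t u : syt lam N) : bits_of (row1 t) N = bits_of (row1 u) N -> t = u.
Proof.
move=> tu; have {}tu i : (i < N)%N -> row1 t i = row1 u i.
  move=> iN; have /eq_in_map H := tu; apply: H.
  by rewrite mem_rev mem_iota.
have E1 : positions (row1 t) N = positions (row1 u) N.
  by apply: eq_in_filter => i; rewrite mem_iota => /tu.
have E0 : positions (predC (row1 t)) N = positions (predC (row1 u)) N.
  by apply: eq_in_filter => i; rewrite mem_iota /= => /tu ->.
apply/val_inj/ffunP => /= c; apply: val_inj => /=.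
by elim/cell_ind2: c => c; rewrite ?entry0 ?entry1 ?E0 ?E1.
Qed.

Section FromWord.
Variable f : nat -> bool.
Hypotheses (fb : ballot (bits_of f N)) (fc : count f (iota 0 N) = b).

Lemma size_positions1 : size (positions f N) = b.
Proof. by rewrite size_filter. Qed.

Lemma size_positions0 : size (positions (predC f) N) = a.
Proof.
by have := count_predC f (iota 0 N); rewrite size_iota size_filter fc addnC => /addIn.
Qed.

(** Inverse construction: the c-th cell of a row receives the position of the c-th
    occurrence of the letter of that row. *)
Definition place (c : cell lam) : nat :=
  nth 0%N (if crow c == 1%N then positions f N else positions (predC f) N) (ccol c).

Lemma place_lt c : (place c < N)%N /\ f (place c) = (crow c == 1%N).
Proof.
rewrite /place; elim/cell_ind2: c => c /=.
  have cs : (c < size (positions (predC f) N))%N by rewrite size_positions0.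
  by have [/negbTE] := nth_positions cs.
have cs : (c < size (positions f N))%N by rewrite size_positions1.
by have [] := nth_positions cs.
Qed.

Definition fill : {ffun cell lam -> 'I_N} :=
  [ffun c => Ordinal (proj1 (place_lt c))].

(** Columns increase because, up to the position of the c-th one, a ballot word has at
    least as many zeros as ones. *)
Lemma fill_standard : standard fill.
Proof.
have u g : uniq (positions g N) by rewrite filter_uniq ?iota_uniq.
have s0 (c : 'I_a) : (c < size (positions (predC f) N))%N by rewrite size_positions0.
have s1 (c : 'I_b) : (c < size (positions f N))%N by rewrite size_positions1.
apply/and4P; split.
- apply/injectiveP => c d; rewrite !ffunE => /(congr1 val) /= cd.
  have := (proj2 (place_lt c)); rewrite cd (proj2 (place_lt d)); move: cd.
  elim/cell_ind2: c => c; elim/cell_ind2: d => d //; rewrite /place /= => /eqP.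
    by rewrite (nth_uniq _ (s0 c) (s0 d) (u _)) => /eqP/val_inj->.
  by rewrite (nth_uniq _ (s1 c) (s1 d) (u _)) => /eqP/val_inj->.
- apply/forallP => i; have [fi|fi] := boolP (f i).
    have ip : val i \in positions f N by rewrite mem_filter fi mem_iota /=.
    have im : (index (val i) (positions f N) < b)%N by rewrite -size_positions1 index_mem.
    apply/codomP; exists (cell1 (Ordinal im)); apply: val_inj.
    by rewrite ffunE /= /place /= nth_index.
  have ip : val i \in positions (predC f) N by rewrite mem_filter /= fi mem_iota /=.
  have im : (index (val i) (positions (predC f) N) < a)%N by rewrite -size_positions0 index_mem.
  apply/codomP; exists (cell0 (Ordinal im)); apply: val_inj.
  by rewrite ffunE /= /place /= nth_index.
- apply/forallP => c; apply/forallP => d; apply/implyP; rewrite !ffunE /=.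
  elim/cell_ind2: c => c; elim/cell_ind2: d => d //= cd.
    exact: positions_lt cd (s0 d).
  exact: positions_lt cd (s1 d).
- apply/forallP => c; apply/forallP => d; apply/implyP; rewrite !ffunE /=.
  elim/cell_ind2: c => c; elim/cell_ind2: d => d //=; rewrite ?andbF // => /andP[/eqP cd _].
  rewrite /place /= /ccol /= in cd *.
  have [/= _ _ E0] := nth_positions (s0 c); have [fy yN E1] := nth_positions (s1 d).
  rewrite ltnNge; apply/negP => le.
  have /ballot_bits_of/(_ _ yN) := fb; rewrite !count_iotaS E1 /= fy addn0.
  by have := leq_count_iota (predC f) le; rewrite E0 cd; lia.
Qed.

Lemma fill_row1 : bits_of (row1 (Syt fill_standard)) N = bits_of f N.
Proof.
apply/eq_in_map => i; rewrite mem_rev mem_iota add0n => /andP[_ iN].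
have [c Ec] := syt_onto (Syt fill_standard) (Ordinal iN).
have -> : i = Syt fill_standard c by rewrite Ec.
by rewrite row1_cell /= ffunE /= (proj2 (place_lt c)).
Qed.

End FromWord.

Lemma tableaux_ballots :
  perm_eq [seq bits_of (row1 (syt_fun t)) N | t <- enum {: syt lam N}] (ballots N b).
Proof.
apply: uniq_perm; [|exact: ballots_uniq|].
  by rewrite map_inj_uniq ?enum_uniq // => t u /row1_inj.
move=> w; rewrite mem_ballots; apply/mapP/and3P => [[t _ ->]|[wb /eqP wc /eqP ws]].
  by rewrite row1_ballot size_bits_of count_bits_of row1_count !eqxx.
pose f i := nth false w (N - i.+1).
have E : w = bits_of f N.
  apply: (@eq_from_nth _ false) => [|i]; rewrite ?size_bits_of // ws => iN.
  rewrite (nth_map 0%N) ?size_rev ?size_iota // nth_rev ?size_iota //.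
  by rewrite nth_iota /f ?add0n; [congr (nth _ _ _); lia | lia].
rewrite E in wb wc *; rewrite count_bits_of in wc.
by exists (Syt (fill_standard wb wc)); rewrite ?mem_enum ?fill_row1.
Qed.

Lemma maj_gen : \sum_(t : syt lam N) 'X^(maj t) = ballot_gen N b.
Proof.
rewrite /ballot_gen -(perm_big _ tableaux_ballots) big_map big_enum.
by apply: eq_bigr => t _; rewrite majE.
Qed.

End TwoRows.

Lemma tab_gen n k : (k <= n)%N ->
  \sum_(t : tab n k) 'X^(maj t) =
  qbin n.*2 (n - k) - (if (n - k)%N is l.+1 then qbin n.*2 l else 0).
Proof.
move=> kn; rewrite -ballot_genE; last by lia.
have E : n.*2 = (n + k + (n - k))%N by lia.
by rewrite /tab; case: _ / (esym E); apply: maj_gen; lia.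
Qed.

Lemma coef_sumX (I : Type) (r : seq I) (P : pred I) (f : I -> nat) m :
  (\sum_(i <- r | P i) 'X^(f i) : {poly int})`_m = (count (fun i => P i && (f i == m)) r)%:R.
Proof.
rewrite coef_sum -sum1_count natr_sum big_mkcondr; apply: eq_bigr => i _.
by rewrite coefXn eq_sym; case: eqP.
Qed.

(** The number of tableaux is the difference between the graded dimensions of two
    adjacent weights, hence a lower bound for the lowest weight vectors. *)
Lemma tab_boxes n k m : (k <= n)%N ->
  (#|[pred t : tab n k | maj t == m]| +
   count (fun s => sumn s == m) (if (n - k)%N is l.+1 then boxes (n + k).+1 l else [::]))%N =
  count (fun s => sumn s == m) (boxes (n + k) (n - k)).
Proof.
move=> kn; have /(congr1 (fun p : {poly int} => p`_m)) := tab_gen kn.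
have C : #|[pred t : tab n k | maj t == m]| =
    count (fun t => true && (maj t == m)) (index_enum (tab n k)).
  by rewrite -sum1_card -sum1_count.
have B a b : (count (fun s => sumn s == m) (boxes a b))%:R = (qbin (a + b) b)`_m :> int.
  by rewrite -boxes_gen coef_sumX.
rewrite coef_sumX -C coefB => E; apply/eqP; rewrite -(eqr_nat int) natrD E B.
have -> : (n + k + (n - k))%N = n.*2 by lia.
case D : (n - k)%N => [|l]; first by rewrite coef0 /= subr0 addr0 eqxx.
have En : ((n + k).+1 + l = n.*2)%N by lia.
by rewrite B En subrK.
Qed.

Lemma card_tab n k : (k <= n)%N ->
  #|tab n k|%:R = 'C(n.*2, n - k)%:R - (if (n - k)%N is l.+1 then 'C(n.*2, l) else 0%N)%:R :> int.
Proof.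
move=> kn; have /(congr1 (fun p : {poly int} => p.[1])) := tab_gen kn.
have -> : (\sum_(t : tab n k) 'X^(maj t) : {poly int}).[1] = #|tab n k|%:R.
  by rewrite horner_sum -sum1_card natr_sum; apply: eq_bigr => t _; rewrite hornerXn expr1n.
rewrite hornerD hornerN qbin1 => ->; congr (_ - _).
by case: (n - k)%N => [|l]; rewrite ?horner0 ?qbin1.
Qed.

(** Summation by parts. *)
Lemma sum_odd_diff (c : nat -> int) K :
  \sum_(k < K) k.*2.+1%:R * (c k - c k.+1) + K.*2.+1%:R * c K = c 0%N + 2 * \sum_(k < K) c k.+1.
Proof.
elim: K => [|K IHK]; first by rewrite !big_ord0 double0; ring.
rewrite [in RHS]big_ord_recr big_ord_recr /= [in RHS]mulrDr [RHS]addrA -IHK doubleS.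
by rewrite -!(natr1 (K.*2.+2)) -!(natr1 (K.*2.+1)) -!(natr1 K.*2); ring.
Qed.

(** The telescoping sum counts C(2n, n - k) twice for k > 0, which accounts for both
    halves of row 2n of the triangle of binomials. *)
Lemma sum_card_tab n : (\sum_(k < n.+1) #|tab n k| * k.*2.+1)%N = (2 ^ n.*2)%N.
Proof.
pose c k : int := if (k <= n)%N then 'C(n.*2, n - k)%:R else 0.
apply/eqP; rewrite -(eqr_nat int) natr_sum; apply/eqP.
transitivity (\sum_(k < n.+1) k.*2.+1%:R * (c k - c k.+1)).
  apply: eq_bigr => k _; rewrite natrM mulrC card_tab -1?ltnS // /c -ltnS ltn_ord.
  congr (_ * (_ - _)); case D : (n - k)%N => [|l].
    by rewrite ifF //; lia.
  by rewrite ifT; [congr (_%:R); congr ('C(_, _)); lia | lia].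
have cn : c n.+1 = 0 by rewrite /c ltnn.
have := sum_odd_diff c n.+1; rewrite cn mulr0 addr0 => ->.
rewrite big_ord_recr /= cn addr0.
have -> : (2 ^ n.*2 = \sum_(0 <= i < n.*2.+1) 'C(n.*2, i))%N.
  rewrite big_mkord -[2%N]/(1 + 1)%N expnDn; apply: eq_bigr => i _.
  by rewrite !exp1n !muln1.
rewrite (@big_cat_nat _ _ _ n) //=; last by lia.
rewrite (@big_cat_nat _ _ _ n.+1 n) //=; last by lia.
rewrite big_nat1.
have E1 : (\sum_(0 <= i < n) 'C(n.*2, i))%N%:R = \sum_(k < n) c k.+1.
  rewrite natr_sum big_nat_rev big_mkord; apply: eq_bigr => i _.
  by rewrite /c ltn_ord add0n.
have E2 : (\sum_(n.+1 <= i < n.*2.+1) 'C(n.*2, i))%N%:R = \sum_(k < n) c k.+1.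
  rewrite -{1}(add0n n.+1) big_addn natr_sum.
  have -> : (n.*2.+1 - n.+1 = n)%N by lia.
  rewrite big_mkord; apply: eq_bigr => i _.
  rewrite /c ltn_ord -bin_sub; last by have := ltn_ord i; lia.
  by congr (_%:R); congr ('C(_, _)); lia.
by rewrite !natrD E1 E2 /c subn0 leq0n; ring.
Qed.

(** * Words as symmetric functions *)

Lemma big_tuple_cons (V : nmodType) (T : finType) l (P : pred (l.+1.-tuple T))
    (F : l.+1.-tuple T -> V) :
  \sum_(t | P t) F t =
  \sum_(x : T) \sum_(t : l.-tuple T | P [tuple of x :: t]) F [tuple of x :: t].
Proof.
rewrite pair_big_dep (reindex (fun p : T * l.-tuple T => [tuple of p.1 :: p.2])) //.
exists (fun t => (thead t, [tuple of behead t])) => [[x t] _|t _] /=.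
  by congr (_, _); apply: val_inj.
by rewrite [RHS]tuple_eta.
Qed.

Section Functions.
Variables (C : numClosedFieldType) (N : nat) (z : 'I_N -> C).

Definition conf (ys : seq 'I_N) : {ffun 'I_N -> 'I_2} :=
  [ffun j => if j \in ys then 1 else 0].

Definition conf_vec (ys : seq 'I_N) : tpow C N := [ffun s => (s == conf ys)%:R].

Definition monom (ys : seq 'I_N) (w : seq nat) : C := \prod_(p <- zip ys w) z p.1 ^+ p.2.

Lemma site_e_conf j ys : site (sl2e C) j (conf_vec ys) = if j \notin ys then conf_vec (j :: ys) else 0.
Proof.
apply/ffunP => s.
have E : (s j == 1) && (update s j 0 == conf ys) = (j \notin ys) && (s == conf (j :: ys)).
  apply/andP/andP => -[].
    move=> /eqP sj /eqP/ffunP us; have jy : j \notin ys.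
      by have := us j; rewrite !ffunE eqxx; case: (j \in ys).
    split=> //; apply/eqP/ffunP => k; have := us k; rewrite !ffunE inE.
    by case: eqP => [->|_ ->].
  move=> jy /eqP->; rewrite ffunE mem_head eqxx; split => //; apply/eqP/ffunP => k.
  by rewrite !ffunE inE; case: eqP => [->|//]; rewrite (negbTE jy).
transitivity (((s j == 1) && (update s j 0 == conf ys))%:R : C).
  rewrite !ffunE (bigD1 0) //= big1 ?addr0 => [|b b0].
    by rewrite !ffunE !mxE eqxx andbT -natrM mulnb.
  by rewrite !mxE (negbTE b0) andbF mul0r.
by rewrite E; case: (j \notin ys); rewrite ffunE.
Qed.

Lemma cur_e_conf i ys :
  cur z (sl2e C) i (conf_vec ys) = \sum_(j | j \notin ys) z j ^+ i *: conf_vec (j :: ys).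
Proof.
rewrite /cur [RHS]big_mkcond; apply: eq_bigr => j _.
by rewrite site_e_conf; case: ifP; rewrite ?scaler0.
Qed.

(** Each letter e_i raises one more site j, with the factor z_j^i. *)
Lemma word_expand l w : size w = l ->
  word z w = \sum_(ys : l.-tuple 'I_N | uniq ys) monom ys w *: conf_vec ys.
Proof.
elim: w l => [|i w IHw] [|l] // => [_|[sw]].
  rewrite (big_pred1 [tuple]) => [|t]; last by rewrite tuple0; apply/esym/eqP/val_inj.
  rewrite /monom big_nil scale1r; apply/ffunP => s; rewrite [LHS]ffunE [RHS]ffunE.
  suff -> : conf [tuple] = [ffun=> 0] by [].
  by apply/ffunP => j; rewrite !ffunE.
rewrite big_tuple_cons /= (IHw l sw) linear_sum.
rewrite (exchange_big_dep (fun t : l.-tuple 'I_N => uniq t)) => [|y t _] /=; last by case/andP.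
apply: eq_bigr => t ut; rewrite linearZ /= cur_e_conf scaler_sumr.
apply: eq_big => [y|y _]; first by rewrite ut andbT.
by rewrite scalerA /monom /= big_cons mulrC.
Qed.

Lemma monom_tnth l (ys : l.-tuple 'I_N) w : size w = l ->
  monom ys w = \prod_(j < l) z (tnth ys j) ^+ nth 0%N w j.
Proof.
elim: l ys w => [|l IHl] ys [|i w] // => [_|[sw]].
  by rewrite big_ord0 /monom tuple0 big_nil.
case/tupleP: ys => y ys; rewrite big_ord_recl /monom /= big_cons tnth0 -[X in _ * X]/(monom ys w) IHl //.
by congr (_ * _); apply: eq_bigr => j _; rewrite tnthS.
Qed.

Lemma monom_tnth_ord l M (ys : l.-tuple 'I_N) (a : l.-tuple 'I_M) :
  monom ys (map val a) = \prod_(j < l) z (tnth ys j) ^+ tnth a j.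
Proof.
rewrite monom_tnth ?size_map ?size_tuple //; apply: eq_bigr => j _.
by rewrite (nth_map (tnth a j)) ?size_tuple // -tnth_nth.
Qed.

Definition wt (s : {ffun 'I_N -> 'I_2}) : nat := \sum_j s j.

Lemma conf_eqP xs ys : reflect (xs =i ys) (conf xs == conf ys).
Proof.
apply: (iffP eqP) => [/ffunP xy j|xy]; last by apply/ffunP => j; rewrite !ffunE xy.
by have := xy j; rewrite !ffunE; do 2!case: (_ \in _).
Qed.

Lemma wt_conf ys : uniq ys -> wt (conf ys) = size ys.
Proof.
move=> /card_uniqP <-; rewrite -sum1_card [RHS]big_mkcond; apply: eq_bigr => j _.
by rewrite ffunE; case: ifP.
Qed.

(** A configuration is the indicator of the list of its up-spins. *)
Lemma confP s : exists2 x : (wt s).-tuple 'I_N, uniq x & s = conf x.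
Proof.
have S : size [seq j <- enum 'I_N | s j == 1] == wt s.
  rewrite size_filter -sum1_count big_enum_cond big_mkcond; apply/eqP.
  by apply: eq_bigr => j _; case: (s j) => -[|[|]].
exists (Tuple S); first by rewrite filter_uniq ?enum_uniq.
apply/ffunP => j; rewrite ffunE mem_filter mem_enum andbT.
case: eqP => [->//|]; case: (s j) => -[|[|m]] //= h nh; first exact: val_inj.
by case: nh; apply: val_inj.
Qed.

Lemma word_wt w s : wt s != size w -> word z w s = 0.
Proof.
move=> sw; rewrite (@word_expand _ w erefl) sum_ffunE big1 // => ys uy; rewrite !ffunE.
by case: eqP => [E|_]; [rewrite E wt_conf // size_tuple eqxx in sw | rewrite [_ *: _]mulr0].
Qed.

(** The sites of a configuration can be raised in any order: a symmetrised monomial. *)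
Lemma word_conf l (x : l.-tuple 'I_N) w : uniq x -> size w = l ->
  word z w (conf x) = \sum_(p : 'S_l) \prod_(j < l) z (tnth x (p j)) ^+ nth 0%N w j.
Proof.
move=> ux sw; rewrite (word_expand sw) sum_ffunE.
pose h (p : 'S_l) := [tuple tnth x (p i) | i < l].
have hI : injective h.
  move=> p q pq; apply/permP => i; have := congr1 (fun t => tnth t i) pq.
  by rewrite !tnth_mktuple => /(tuple_uniqP _ ux).
transitivity (\sum_(ys in [set h p | p in [set: 'S_l]]) monom ys w).
  rewrite big_mkcond [RHS]big_mkcond; apply: eq_bigr => ys _; rewrite !ffunE.
  have -> : (ys \in [set h p | p in [set: 'S_l]]) = uniq ys && (conf x == conf ys).
    apply/imsetP/andP => [[p _ ->]|[uy /conf_eqP xy]].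
      split; first by apply/tuple_uniqP => i j; rewrite !tnth_mktuple => /(tuple_uniqP _ ux)/perm_inj.
      have /perm_mem E : perm_eq (h p) x by apply/tuple_permP; exists p.
      by apply/conf_eqP => j; rewrite -E.
    have /tuple_permP[p Ep] : perm_eq ys x by apply: uniq_perm => // j; rewrite xy.
    by exists p => //; apply: val_inj.
  by case: (uniq ys) => //=; case: eqP => _; rewrite ?[_ *: _]mulr1 ?[_ *: _]mulr0.
rewrite big_imset => [|p q _ _ /hI//]; apply: eq_big => [p|p _]; first by rewrite inE.
by rewrite monom_tnth //; apply: eq_bigr => j _; rewrite tnth_mktuple.
Qed.

(** * Independence of the words from a box *)

Hypothesis z_inj : injective z.

(** Fix all variables but one: a polynomial of degree less than M in that variable
    vanishes at the remaining points, of which there are at least M. *)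
Lemma monom_free l M (c : l.-tuple 'I_M -> C) : (l + M <= N.+1)%N ->
  (forall x : l.-tuple 'I_N, uniq x -> \sum_a c a * monom x (map val a) = 0) ->
  forall a, c a = 0.
Proof.
elim: l c => [|l IHl] c lM c0 a.
  have := c0 [tuple] isT; rewrite (big_pred1 a) => [|b]; last by rewrite (tuple0 b) (tuple0 a); apply/esym/eqP.
  by rewrite /monom; case: (map _ _) => [|m w]; rewrite /= big_nil mulr1.
case/tupleP: a => b a.
pose g b := fun a' : l.-tuple 'I_M => c [tuple of b :: a'].
suff : forall x : l.-tuple 'I_N, uniq x -> \sum_a g b a * monom x (map val a) = 0.
  by move=> H; apply: (IHl (g b)) => //; lia.
move=> x ux; pose p := \sum_b0 (\sum_a g b0 a * monom x (map val a)) *: 'X^b0 : {poly C}.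
have pE : p = \poly_(i < M) (if insub i is Some b0 then \sum_a g b0 a * monom x (map val a) else 0).
  rewrite poly_def /p; apply: eq_bigr => i _.
  by rewrite insubT //= => iM; congr (_ *: _); apply: eq_bigr => a' _; congr (g _ _ * _); apply: val_inj.
suff p0 : p = 0.
  have := congr1 (fun q : {poly C} => q`_b) p0; rewrite coef0 pE coef_poly ltn_ord.
  by rewrite valK.
pose rs := [seq z y | y <- enum [predC x]].
apply: (@roots_geq_poly_eq0 _ _ rs).
- apply/allP => _ /mapP[y + ->]; rewrite mem_enum inE => yx.
  have /c0 : uniq [tuple of y :: x] by rewrite /= yx.
  rewrite big_tuple_cons => E; apply/rootP; rewrite -[RHS]E /p horner_sum.
  apply: eq_bigr => b0 _; rewrite hornerZ hornerXn mulr_suml; apply: eq_bigr => a' _.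
  rewrite /g /monom /= big_cons /=; ring.
- by rewrite map_inj_uniq ?enum_uniq.
rewrite size_map -cardE pE; apply: leq_trans (size_poly _ _) _.
have := cardC (mem x); rewrite card_ord (card_uniqP ux) size_tuple => E.
by rewrite -(@leq_add2l l) E; lia.
Qed.

End Functions.

Section Dims.
Variables (C : numClosedFieldType) (N : nat) (z : 'I_N -> C).
Hypothesis z_inj : injective z.

(** Rearrangements of different partitions are different exponent vectors, so a linear
    relation between the words is a polynomial with the same coefficients up to
    nonzero factors, to which monom_free applies. *)
Lemma words_free l m (L : seq (seq nat)) : (l + m <= N)%N ->
  uniq L -> {subset L <= boxes m l} -> free [seq word z s | s <- L].
Proof.
move=> lmN uL Lb; apply/(freeP (X := in_tuple _)) => k.
set n := size _ in k * => k0 i0; pose lam i := nth [::] L i.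
have nL : n = size L by rewrite /n size_map.
have lamP (i : 'I_n) : [/\ size (lam i) = l, all (leq^~ m) (lam i) & sorted geq (lam i)].
  have /Lb : lam i \in L by rewrite mem_nth // -nL.
  by rewrite mem_boxes => /and3P[/eqP].
pose a_ (i : 'I_n) (p : 'S_l) : l.-tuple 'I_m.+1 :=
  [tuple inord (nth 0%N (lam i) ((p^-1)%g j)) | j < l].
have aE i p j : tnth (a_ i p) (p j) = nth 0%N (lam i) j :> nat.
  have [sl /allP la _] := lamP i.
  by rewrite tnth_mktuple permK inordK // ltnS; apply/la/mem_nth; rewrite sl.
(* the coefficient of the monomial a in the sum of the k i times the i-th word *)
pose c a := \sum_i k i * \sum_p (a_ i p == a)%:R.
have c0 : forall a, c a = 0.
  apply: (@monom_free C N z z_inj); first by rewrite addnS ltnS.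
  move=> x ux; have := congr1 (fun v : tpow C N => v (conf x)) k0.
  rewrite sum_ffunE [RHS]ffunE => E; rewrite -[RHS]E.
  transitivity (\sum_a \sum_i k i * (\sum_p (a_ i p == a)%:R) * monom z x (map val a)).
    by apply: eq_bigr => a _; rewrite mulr_suml.
  rewrite exchange_big; apply: eq_bigr => i _; have [sl _ _] := lamP i.
  rewrite ffunE (nth_map [::]) -?nL // -/(lam i) (word_conf z ux sl) -[_ *: _]/(_ * _).
  transitivity (\sum_a \sum_p k i * (a_ i p == a)%:R * monom z x (map val a)).
    by apply: eq_bigr => a _; rewrite mulr_sumr mulr_suml.
  rewrite exchange_big mulr_sumr; apply: eq_bigr => p _.
  rewrite (bigD1 (a_ i p)) // big1 => [|b bn]; last first.
    by rewrite eq_sym (negbTE bn) mulr0 mul0r.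
  rewrite eqxx mulr1 [LHS]addr0; congr (_ * _); rewrite monom_tnth_ord.
  by rewrite (reindex_inj (@perm_inj _ p)); apply: eq_bigr => j _; rewrite aE.
have := c0 (a_ i0 1%g); rewrite /c (bigD1 i0) //= [X in _ + X]big1 ?addr0 => [|i ni].
  move/eqP; rewrite mulf_eq0 => /orP[/eqP//|]; rewrite psumr_eq0 // => /allP/(_ 1%g).
  by rewrite mem_index_enum eqxx oner_eq0 => /(_ isT).
rewrite big1 ?mulr0 // => p _; case: eqP => // E; case/eqP: ni.
have [s1 _ o1] := lamP i; have [s0 _ o0] := lamP i0.
have anti : antisymmetric geq.
  by move=> u v /andP[uv vu]; apply/eqP; rewrite eqn_leq; apply/andP.
have : lam i = lam i0.
  apply: (sorted_eq (rev_trans leq_trans) anti o1 o0).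
  have sT : size (lam i0) == l by apply/eqP.
  have H : perm_eq (lam i) (Tuple sT); last exact: H.
  apply/tuple_permP; exists p; apply: (@eq_from_nth _ 0%N); first by rewrite size_tuple.
  move=> j; rewrite s1 => jl.
  have := congr1 (fun t => val (tnth t (p (Ordinal jl)))) E; rewrite /= aE /= => ->.
  have := aE i0 1%g (p (Ordinal jl)); rewrite perm1 => ->.
  rewrite -[j in RHS]/(val (Ordinal jl)) (nth_map (Ordinal jl)) ?size_enum_ord //.
  by rewrite nth_ord_enum (tnth_nth 0%N).
move=> EE; apply/val_inj/eqP.
have il (j : 'I_n) : (j < size L)%N by rewrite -nL.
by rewrite -(nth_uniq [::] (il i) (il i0) uL); apply/eqP.
Qed.
End Dims.

(** * Alternants *)

Section Alternants.
Variables (C : numClosedFieldType) (N : nat) (z : 'I_N -> C).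

Definition alternant_mx l (nu : 'I_l -> nat) (x : l.-tuple 'I_N) : 'M[C]_l :=
  \matrix_(i, j) z (tnth x j) ^+ nu i.

Definition alternant l (nu : 'I_l -> nat) : {ffun l.-tuple 'I_N -> C^o} :=
  [ffun x => \det (alternant_mx nu x)].

Lemma eq_alternant l (nu mu : 'I_l -> nat) : nu =1 mu -> alternant nu = alternant mu.
Proof.
move=> nm; apply/ffunP => x; rewrite !ffunE; congr (\det _).
by apply/matrixP => i j; rewrite !mxE nm.
Qed.

Lemma alternant_repeat l (nu : 'I_l -> nat) i1 i2 : i1 != i2 -> nu i1 = nu i2 -> alternant nu = 0.
Proof.
move=> ni e; apply/ffunP => x; rewrite !ffunE.
by apply: (determinant_alternate ni) => j; rewrite !mxE e.
Qed.

Lemma alternant_perm l (nu : 'I_l -> nat) (p : 'S_l) :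
  alternant (nu \o p) = (-1) ^+ p *: alternant nu.
Proof.
apply/ffunP => x; rewrite !ffunE -[_ *: _]/(_ * _) -det_perm -det_mulmx -row_permE.
by congr (\det _); apply/matrixP => i j; rewrite !mxE.
Qed.

(** The z_j are the roots of a monic polynomial of degree N. *)
Lemma z_pow_reduce : exists c : 'I_N -> C, forall j, z j ^+ N = \sum_b c b * z j ^+ b.
Proof.
pose p := \prod_j ('X - (z j)%:P); exists (fun b => - p`_b) => j.
have sp : size p = N.+1 by rewrite size_prod_XsubC /index_enum -enumT size_enum_ord.
have : p.[z j] = 0 by rewrite horner_prod (bigD1 j) //= !hornerE subrr mul0r.
have lc : p`_N = 1.
  have /monicP : p \is monic by apply: monic_prod_XsubC.
  by rewrite lead_coefE sp.
rewrite horner_coef sp big_ord_recr /= lc mul1r => /eqP; rewrite addrC addr_eq0 => /eqP ->.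
by rewrite -sumrN; apply: eq_bigr => b _; rewrite mulNr.
Qed.

(** Expand the determinant along row i and reduce the power of z there. *)
Lemma alternant_reduce l (nu : 'I_l -> nat) i : (N <= nu i)%N -> exists c : 'I_N -> C,
  alternant nu = \sum_b c b *: alternant (fun j => if j == i then nu i - N + b else nu j)%N.
Proof.
move=> Ni; have [c cz] := z_pow_reduce; exists c; apply/ffunP => x.
rewrite sum_ffunE ffunE (expand_det_row _ i).
transitivity (\sum_b \sum_j c b * z (tnth x j) ^+ (nu i - N + b) * cofactor (alternant_mx nu x) i j).
  rewrite exchange_big; apply: eq_bigr => j _; rewrite mxE -{1}(subnK Ni) exprD cz.
  rewrite -mulr_suml; congr (_ * _); rewrite mulr_sumr; apply: eq_bigr => b _.
  by rewrite exprD mulrCA.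
apply: eq_bigr => b _; rewrite !ffunE -[_ *: _]/(_ * _) (expand_det_row _ i) mulr_sumr.
apply: eq_bigr => j _; rewrite mxE eqxx [RHS]mulrA; congr (_ * _).
congr (_ * \det _).
by apply/matrixP => i' j'; rewrite !mxE eq_sym (negbTE (neq_lift _ _)).
Qed.

Section Fixed.
Variable l : nat.

Definition add_delta (s : seq nat) (i : 'I_l) : nat := (nth 0%N s i + (l - i.+1))%N.

Definition delta_sum : nat := \sum_(i < l) (l - i.+1).

Definition alternants (m : nat) : {vspace {ffun l.-tuple 'I_N -> C^o}} :=
  <<[seq alternant (add_delta s) | s <- boxes (N - l) l & (sumn s < m)%N]>>%VS.

Lemma sumn_add_delta s : size s = l -> \sum_(i < l) add_delta s i = (sumn s + delta_sum)%N.
Proof.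
move=> sl; rewrite big_split /=; congr addn.
by rewrite sumnE (big_nth 0%N) big_mkord sl.
Qed.

(** A strictly decreasing sequence below N is a partition in the box plus
    (l - 1, ..., 0). *)
Lemma sub_delta (s : seq nat) : sorted gtn s -> size s = l -> all (gtn N) s ->
  exists2 t, t \in boxes (N - l) l & forall i : 'I_l, nth 0%N s i = add_delta t i.
Proof.
move=> so sl sN; have step i : (i.+1 < l)%N -> (nth 0 s i.+1 < nth 0 s i)%N.
  by rewrite -sl; apply: (sortedP 0%N so).
have up i : (i < l)%N -> (nth 0 s i + i < N)%N.
  elim: i => [l0|i IHi il]; first by rewrite addn0; apply/(allP sN)/mem_nth; rewrite sl.
  by have := IHi (ltnW il); have := step i il; lia.
have down k i : (i + k.+1 = l)%N -> (k <= nth 0 s i)%N.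
  elim: k i => // k IHk i ik; have := IHk i.+1; have := step i; lia.
exists (mkseq (fun i => nth 0 s i - (l - i.+1))%N l); last first.
  move=> i; rewrite /add_delta nth_mkseq // subnK //; apply: down; have := ltn_ord i; lia.
rewrite mem_boxes size_mkseq eqxx andTb; apply/andP; split.
  apply/(all_nthP 0%N) => i; rewrite size_mkseq => il; rewrite nth_mkseq //=.
  by have := up i il; have := down (l - i.+1)%N i; lia.
apply/(sortedP 0%N) => i; rewrite size_mkseq => il; rewrite !nth_mkseq //=; last by lia.
by have := step i il; lia.
Qed.

(** Lower the exponents until they are below N, by induction on their sum; then the
    alternant vanishes or its exponents can be sorted. *)
Lemma alternant_span (nu : 'I_l -> nat) m :
  (\sum_i nu i < m + delta_sum)%N -> alternant nu \in alternants m.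
Proof.
move: {2}(\sum_i nu i)%N (erefl (\sum_i nu i)%N) => d.
elim/ltn_ind: d nu => d IHd nu Ed dm.
have [/existsP[i Ni]|] := boolP [exists i, (N <= nu i)%N].
  have [c ->] := alternant_reduce Ni; apply: memv_suml => b _; apply: memvZ.
  have lt : (\sum_j (if j == i then nu i - N + b else nu j) < \sum_j nu j)%N.
    rewrite (bigD1 i) // [X in (_ < X)%N](bigD1 i) //= eqxx -addSn.
    apply: leq_add; first by have := ltn_ord b; lia.
    by apply: leq_sum => j /negbTE->.
  by apply: (IHd _ _ _ erefl); [rewrite -Ed | apply: ltn_trans dm].
rewrite negb_exists => /forallP nuN.
have [/injectiveP nuI|] := boolP (injectiveb nu); last first.
  by case/injectivePn => i [j ij e]; rewrite (alternant_repeat ij e) mem0v.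
pose t := [tuple nu i | i < l]; pose s := sort geq t.
have st : perm_eq t s by rewrite perm_sym perm_sort.
have sz : size s == l by rewrite size_sort size_tuple.
have us : uniq s by rewrite sort_uniq; apply/tuple_uniqP => i j; rewrite !tnth_mktuple => /nuI.
have so : sorted gtn s.
  rewrite gtn_sorted_uniq_geq us; apply: sort_sorted => x y; exact: leq_total.
have sN : all (gtn N) s.
  by rewrite all_sort; apply/allP => _ /mapP[i _ ->]; rewrite /= ltnNge.
have [u ub us_] := sub_delta so (eqP sz) sN.
have /tuple_permP[p Ep] : perm_eq t (Tuple sz) by [].
have nuE : nu =1 add_delta u \o p.
  move=> i; rewrite /= -us_ -[LHS](tnth_mktuple nu) (tnth_nth 0%N) -/t Ep.
  by rewrite -(tnth_nth 0%N) tnth_mktuple (tnth_nth 0%N).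
rewrite (eq_alternant nuE) alternant_perm; apply/memvZ/memv_span/(map_f (fun s => alternant (add_delta s))).
rewrite mem_filter ub andbT.
rewrite -(ltn_add2r delta_sum) -sumn_add_delta; last by move: ub; rewrite mem_boxes => /andP[/eqP].
apply: leq_ltn_trans dm; rewrite (reindex_inj (@perm_inj _ p)) leq_eqVlt.
by apply/orP; left; apply/eqP/eq_bigr => i _; rewrite nuE.
Qed.

End Fixed.
End Alternants.

Section WeightFiltration.
Variables (C : numClosedFieldType) (N : nat) (z : 'I_N -> C).

Definition vandermonde l (x : l.-tuple 'I_N) : C := alternant z (fun i => l - i.+1)%N x.

Definition mul_vandermonde l (v : tpow C N) : {ffun l.-tuple 'I_N -> C^o} :=
  [ffun x : l.-tuple 'I_N => if uniq x then v (conf x) * vandermonde x else 0].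

Fact mul_vandermonde_linear l : linear (@mul_vandermonde l).
Proof.
move=> a v w; apply/ffunP => x; rewrite !ffunE; case: ifP => _; last by rewrite scaler0 addr0.
by rewrite mulrDl -[_ *: _]/(_ * _) -[_ *: _]/(_ * _) mulrA.
Qed.
HB.instance Definition _ l := GRing.isLinear.Build C (tpow C N)
  {ffun l.-tuple 'I_N -> C^o} _ (@mul_vandermonde l) (@mul_vandermonde_linear l).

(** Distribute; in the term of q of the determinant, reindexing the symmetric sum by
    p^-1 * q collects the exponents at each point. *)
Lemma mul_vandermonde_word l w : size w = l ->
  mul_vandermonde l (word z w) = \sum_(p : 'S_l) alternant z (fun i => nth 0 w (p i) + (l - i.+1))%N.
Proof.
move=> sw; apply/ffunP => x; rewrite sum_ffunE ffunE; case: ifP => [ux|nux]; last first.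
  rewrite big1 // => p _; rewrite ffunE -det_tr.
  have /tuple_uniqP H := negbT nux.
  have [i [j [ij e]]] : exists i j, i != j /\ tnth x i = tnth x j.
    apply: contrapT => nij; apply: H => i j e; apply/eqP/negPn/negP => ne.
    by apply: nij; exists i, j.
  by apply: (determinant_alternate ij) => k; rewrite !mxE e.
rewrite (word_conf z ux sw) /vandermonde ffunE /determinant mulr_sumr.
transitivity (\sum_(q : 'S_l) \sum_(p : 'S_l) (-1) ^+ q *
    \prod_i z (tnth x (q i)) ^+ (nth 0 w (p i) + (l - i.+1))%N); last first.
  rewrite exchange_big; apply: eq_bigr => p _; rewrite ffunE /determinant.
  by apply: eq_bigr => q _; congr (_ * _); apply: eq_bigr => i _; rewrite mxE.
apply: eq_bigr => q _; rewrite -mulr_sumr mulrCA; congr (_ * _).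
rewrite (reindex_inj (h := fun p : 'S_l => (p^-1 * q)%g)) => [|p p' /mulIg/invg_inj//].
rewrite mulr_suml; apply: eq_bigr => p _ /=.
rewrite (reindex_inj (@perm_inj _ p)) -big_split; apply: eq_bigr => i _ /=.
by rewrite permM permK exprD mxE.
Qed.

Hypothesis z_inj : injective z.

Lemma vandermonde_neq0 l (x : l.-tuple 'I_N) : uniq x -> vandermonde x != 0.
Proof.
move=> ux; have E : (fun i : 'I_l => l - i.+1)%N =1 val \o perm (@rev_ord_inj l).
  by move=> i; rewrite /= permE.
rewrite /vandermonde (eq_alternant z E) (@alternant_perm C N z l val) !ffunE -[_ *: _]/(_ * _) mulf_neq0 ?signr_eq0 //.
pose a : 'rV[C]_l := \row_j z (tnth x j).
have -> : alternant_mx z val x = Vandermonde l a by apply/matrixP => i j; rewrite !mxE.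
rewrite det_Vandermonde; apply/prodf_neq0 => i _; apply/prodf_neq0 => j ij.
rewrite !mxE subr_eq0; apply/negP => /eqP/z_inj/(tuple_uniqP _ ux) e.
by rewrite e ltnn in ij.
Qed.

(** The weight l part of Vlt m (see Vlt_Vwt). *)
Definition Vwt (l m : nat) : {vspace tpow C N} :=
  spanset [set v | exists2 s, size s = l /\ (sumn s < m)%N & v = word z s].

Lemma Vwt_word s m : (sumn s < m)%N -> word z s \in Vwt (size s) m.
Proof. by move=> sm; apply: spanset_sub; exists s. Qed.

(** The words of length l are supported on configurations of weight l. *)
Lemma Vwt_supp l m v s : v \in Vwt l m -> wt s != l -> v s = 0.
Proof.
move=> vV sl; pose ev (w : tpow C N) : C^o := w s.
have evL : linear ev by move=> a w w'; rewrite /ev !ffunE.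
pose EV := GRing.isLinear.Build C (tpow C N) C^o _ ev evL.
pose evl : {linear tpow C N -> C^o} := HB.pack ev EV.
have : (Vwt l m <= lker (linfun evl))%VS.
  apply: spanset_min => _ [w [sw _] ->]; rewrite memv_ker lfunE /= /ev word_wt //.
  by rewrite sw.
by move/subvP => /(_ v vV); rewrite memv_ker lfunE => /eqP.
Qed.

(** The lower bound is words_free, the upper bound alternant_span. *)
Lemma dim_Vwt l m : (l <= N)%N ->
  \dim (Vwt l m) = count (fun s => sumn s < m)%N (boxes (N - l) l).
Proof.
move=> lN; pose L := [seq s <- boxes (N - l) l | (sumn s < m)%N].
rewrite -size_filter -/L; apply/eqP; rewrite eqn_leq; apply/andP; split; last first.
  have F : free [seq word z s | s <- L].
    apply: (@words_free C N z z_inj l (N - l)%N); first by rewrite subnKC.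
      exact/filter_uniq/boxes_uniq.
    exact/mem_subseq/filter_subseq.
  rewrite -(size_map (word z)) -(eqP F); apply/dimvS/span_subvP => _ /mapP[s + ->].
  rewrite mem_filter mem_boxes => /and3P[sm /eqP <- _]; exact: Vwt_word.
have T0 : (Vwt l m :&: lker (linfun (@mul_vandermonde l)) = 0)%VS.
  apply/eqP; rewrite -subv0; apply/subvP => v; rewrite memv_cap memv_ker lfunE /=.
  case/andP => vV /eqP/ffunP v0; rewrite memv0; apply/eqP/ffunP => s; rewrite [RHS]ffunE.
  have [sl|/(Vwt_supp vV)//] := eqVneq (wt s) l.
  have [x ux ->] := confP s; move: x ux; rewrite sl => x ux.
  have := v0 x; rewrite !ffunE ux => /eqP; rewrite mulf_eq0 (negbTE (vandermonde_neq0 ux)) orbF.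
  by move/eqP.
rewrite -(limg_dim_eq T0).
have : (linfun (@mul_vandermonde l) @: Vwt l m <= alternants z l m)%VS.
  suff sub : (Vwt l m <= linfun (@mul_vandermonde l) @^-1: alternants z l m)%VS.
    by apply/subvP => _ /memv_imgP[v vV ->]; rewrite memv_preim; apply: (subvP sub).
  apply: spanset_min => _ [s [sl sm] ->].
  rewrite -memv_preim lfunE /= mul_vandermonde_word //; apply: memv_suml => p _.
  apply: alternant_span; rewrite big_split /= ltn_add2r; apply: leq_ltn_trans sm.
  by rewrite sumnE (big_nth 0%N) big_mkord sl [in X in (_ <= X)%N](reindex_inj (@perm_inj _ p)).
move/dimvS/leq_trans; apply; apply: leq_trans (dim_span _) _; by rewrite size_map.
Qed.

End WeightFiltration.

(** * Unitary lowest weight modules *)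

Section InnerProduct.
Variables (C : numClosedFieldType) (V : lmodType C) (ip : {dot V for (@conjC C)}).

Lemma ip_conj u v : ip u v = (ip v u)^*.
Proof. by rewrite hermC expr0 mul1r. Qed.

Lemma ipZl a u v : ip (a *: u) v = a * ip u v.
Proof. exact: linearZl_LR. Qed.

Lemma ipZr a u v : ip u (a *: v) = a^* * ip u v.
Proof. exact: linearZr_LR. Qed.

Lemma ip_gt0 u : u != 0 -> 0 < ip u u.
Proof. exact: neq0_dnorm_gt0. Qed.

Lemma ip_eq0 u : ip u u = 0 -> u = 0.
Proof. by move=> u0; have [//|/ip_gt0] := eqVneq u 0; rewrite u0 ltxx. Qed.

(** Gram-Schmidt for the form pulled back along f, which is definite on U. *)
Lemma gram_schmidt (W : vectType C) (f : {linear W -> V}) (U : {vspace W}) p :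
  (forall w, w \in U -> f w = 0 -> w = 0) -> (p <= \dim U)%N ->
  exists s : seq W, [/\ size s = p, {subset s <= U} &
    forall i j, (i < p)%N -> (j < p)%N -> ip (f s`_i) (f s`_j) = (i == j)%:R].
Proof.
move=> fI; elim: p => [|p IHp] pU; first by exists [::].
have [s [ss sU so]] := IHp (ltnW pU).
have /subvPn[w wU ws] : ~~ (U <= <<s>>)%VS.
  by apply: contraL pU => /dimvS/leq_trans/(_ (dim_span _)); rewrite ss -ltnNge.
pose w' := w - \sum_(i < p) ip (f w) (f s`_i) *: s`_i.
have siU (i : 'I_p) : s`_i \in U by apply/sU/mem_nth; rewrite ss.
have w'U : w' \in U by rewrite memvB // memv_suml // => i _; apply: memvZ.
have w'0 : w' != 0.
  apply: contra ws; rewrite subr_eq0 => /eqP->; apply: memv_suml => i _.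
  by apply/memvZ/memv_span/mem_nth; rewrite ss.
have ort j : (j < p)%N -> ip (f w') (f s`_j) = 0.
  move=> jp; rewrite linearB linear_sum linearBl linear_sumlz (bigD1 (Ordinal jp)) //= big1.
    by rewrite linearZ /= ipZl so // eqxx mulr1 addr0 subrr.
  move=> i ni; rewrite linearZ /= ipZl so // (_ : (i : nat) == j = false) ?mulr0 //.
  exact: negbTE ni.
set nrm := ip (f w') (f w'); have nrm0 : 0 < nrm.
  by apply: ip_gt0; apply: contra w'0 => /eqP /(fI _ w'U) ->.
pose a := (sqrtC nrm)^-1; exists (rcons s (a *: w')).
have aR : a^* = a by apply: geC0_conj; rewrite invr_ge0 sqrtC_ge0 ltW.
split; first by rewrite size_rcons ss.
  by move=> u; rewrite mem_rcons inE => /orP[/eqP->|/sU//]; apply: memvZ.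
move=> i j; rewrite !nth_rcons ss !(ltnS _ p) (leq_eqVlt i) (leq_eqVlt j).
have ne (q r : nat) : (q < r)%N -> (q == r) = false /\ (r == q) = false.
  by move=> qr; rewrite (gtn_eqF qr) (ltn_eqF qr).
case/orP=> [/eqP->|ip1]; case/orP=> [/eqP->|jp].
- rewrite ltnn !eqxx linearZ /= ipZl ipZr aR -/nrm mulrA -expr2 exprVn sqrtCK mulVf //.
  by rewrite gt_eqF.
- by rewrite ltnn eqxx jp linearZ /= ipZl ort // mulr0 (proj2 (ne _ _ jp)).
- by rewrite ltnn eqxx ip1 linearZ /= ipZr ip_conj ort // conjC0 mulr0 (proj1 (ne _ _ ip1)).
by rewrite ip1 jp so.
Qed.

End InnerProduct.

Section Strings.
Variables (C : numClosedFieldType) (V : lmodType C) (rho : sl2rep V).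
Variables (ip : {dot V for (@conjC C)}).
Hypothesis unit_ip : sl2_unitary rho ip.

(** Lowest weight vectors of copies of M_(2k+1), whose lowest weight is - 2k. *)
Definition lowest (k : nat) (b : V) : Prop :=
  repF rho b = 0 /\ repH rho b = - (k.*2)%:R *: b.

Let Ei i b := iter i (repE rho) b.

Lemma H_Ei k b i : lowest k b -> repH rho (Ei i b) = ((i.*2)%:R - (k.*2)%:R) *: Ei i b.
Proof.
case=> _ Hb; elim: i => [|i IHi]; first by rewrite /= Hb double0 sub0r.
have := repHE rho (Ei i b); rewrite IHi linearZ /= => /eqP; rewrite subr_eq => /eqP ->.
rewrite -scalerDl; congr (_ *: _).
by rewrite doubleS -addn2 natrD; ring.
Qed.

Lemma F_Ei k b i : lowest k b ->
  repF rho (Ei i.+1 b) = (i.+1%:R * ((k.*2)%:R - i%:R)) *: Ei i b.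
Proof.
move=> kb; have [Fb _] := kb.
have FE v : repF rho (repE rho v) = repE rho (repF rho v) - repH rho v.
  by rewrite -(repEF rho v) opprB addrC subrK.
elim: i => [|i IHi].
  rewrite /= FE Fb linear0 sub0r (proj2 kb) -scaleNr opprK; congr (_ *: _).
  by rewrite mul1r subr0.
rewrite [Ei i.+2 b]/= FE IHi linearZ /= (H_Ei i.+1 kb) -scalerBl; congr (_ *: _).
by rewrite doubleS -!addnn -!natr1 !natrD; ring.
Qed.

Lemma ip_Ei k k' b b' i : lowest k b -> lowest k' b' ->
  ip (Ei i b) (Ei i b') = \prod_(j < i) (j.+1%:R * ((k'.*2)%:R - j%:R)) * ip b b'.
Proof.
move=> kb kb'; elim: i => [|i IHi]; first by rewrite big_ord0 mul1r.
rewrite [Ei i.+1 b]/= (proj1 unit_ip) (F_Ei i kb') ipZr IHi big_ord_recr /= mulrA.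
rewrite rmorphM rmorphB !rmorph_nat; ring.
Qed.

(** Move raising operators across the inner product until one of them, turned into a
    lowering operator, reaches a lowest weight vector. *)
Lemma ip_Ei_neq k k' b b' i j : lowest k b -> lowest k' b' -> i != j ->
  ip (Ei i b) (Ei j b') = 0.
Proof.
move=> kb kb'; elim: i j => [|i IHi] [|j] // ij.
- by rewrite ip_conj [Ei j.+1 _]/= (proj1 unit_ip) (proj1 kb) linear0r conjC0.
- by rewrite [Ei i.+1 _]/= (proj1 unit_ip) (proj1 kb') linear0r.
by rewrite [Ei i.+1 b]/= (proj1 unit_ip) (F_Ei j kb') ipZr IHi ?mulr0.
Qed.

(** Eigenvectors of the self-adjoint h with different eigenvalues. *)
Lemma ip_lowest_neq k k' b b' : lowest k b -> lowest k' b' -> k != k' -> ip b b' = 0.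
Proof.
move=> [_ Hb] [_ Hb'] kk; have := proj2 unit_ip b b'.
rewrite Hb Hb' ipZl ipZr rmorphN /= conjC_nat => /eqP.
by rewrite -subr_eq0 -mulrBl mulf_eq0 opprK addrC subr_eq0 eqr_nat
  (inj_eq double_inj) eq_sym (negbTE kk) => /eqP.
Qed.

(** Unitarity forces the string to stop: the factor 2k - j of ip_Ei vanishes at
    j = 2k. *)
Lemma Ei_stop k b : lowest k b -> Ei k.*2.+1 b = 0.
Proof.
move=> kb; apply: (@ip_eq0 _ _ ip); rewrite (ip_Ei _ kb kb) big_ord_recr /= subrr.
by rewrite !mulr0 mul0r.
Qed.

Definition string_norm (k j : nat) : C := \prod_(i < j) sqrtC (i.+1 * (k.*2 - i))%:R.

(** The image of u_j in the copy of M_(2k+1) generated by b. *)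
Definition stringv (k : nat) (b : V) (j : nat) : V := (string_norm k j)^-1 *: Ei j b.

Lemma string_norm_neq0 k j : (j <= k.*2)%N -> string_norm k j != 0.
Proof.
move=> jk; apply/prodf_neq0 => i _; rewrite sqrtC_eq0 pnatr_eq0 muln_eq0 /= subn_eq0.
by rewrite -ltnNge (leq_trans (ltn_ord i)).
Qed.

Lemma string_normS k j : string_norm k j.+1 = string_norm k j * sqrtC (j.+1 * (k.*2 - j))%:R.
Proof. by rewrite /string_norm big_ord_recr. Qed.

Lemma stringvS k b j : (j < k.*2)%N ->
  repE rho (stringv k b j) = sqrtC (j.+1 * (k.*2 - j))%:R *: stringv k b j.+1.
Proof.
move=> jk; rewrite /stringv linearZ /= scalerA string_normS; congr (_ *: _).
have := string_norm_neq0 jk; rewrite string_normS mulf_eq0 negb_or => /andP[n0 s0].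
by rewrite invfM mulrCA mulfV // mulr1.
Qed.

Lemma stringvE k b (i : 'I_k.*2.+1) : lowest k b ->
  repE rho (stringv k b i) = \sum_(j < k.*2.+1) irrE C k j i *: stringv k b j.
Proof.
move=> kb; have [ik|ik] := ltnP i k.*2.
  have iS : (i.+1 < k.*2.+1)%N by [].
  rewrite stringvS // (bigD1 (Ordinal iS)) //= big1 => [|j ji].
    by rewrite mxE eqxx addr0.
  by rewrite mxE ifF ?scale0r //; apply: negbTE ji.
have Ei_ : i = k.*2 :> nat by apply/eqP; rewrite eqn_leq ik -ltnS ltn_ord.
rewrite /stringv linearZ /= -[repE rho _]/(Ei i.+1 b) Ei_ Ei_stop // scaler0 big1 // => j _.
by rewrite mxE ifF ?scale0r //; rewrite Ei_ ltn_eqF.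
Qed.

Lemma stringvF k b (i : 'I_k.*2.+1) : lowest k b ->
  repF rho (stringv k b i) = \sum_(j < k.*2.+1) irrF C k j i *: stringv k b j.
Proof.
move=> kb; case: i => -[|i] ik.
  rewrite /stringv linearZ /= (proj1 kb) scaler0 big1 // => j _.
  by rewrite !mxE /= scale0r.
have ik' : (i < k.*2.+1)%N by apply: ltnW.
rewrite (bigD1 (Ordinal ik')) //= big1 => [|j ji]; last first.
  by rewrite !mxE /= eqSS eq_sym ifF ?scale0r //; apply: negbTE ji.
rewrite !mxE /= eqxx addr0 /stringv linearZ /= -[repE rho _]/(Ei i.+1 b) (F_Ei i kb) !scalerA.
congr (_ *: _); have := @string_norm_neq0 k i.+1 ik; rewrite string_normS mulf_eq0 negb_or => /andP[n0 s0].
rewrite invfM -mulrA [RHS]mulrC; congr (_ * _).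
apply: (mulfI s0); rewrite mulrA mulfV // mul1r -expr2 sqrtCK natrM natrB //.
Qed.

Lemma stringvH k b (i : 'I_k.*2.+1) : lowest k b ->
  repH rho (stringv k b i) = \sum_(j < k.*2.+1) irrH C k j i *: stringv k b j.
Proof.
move=> kb; rewrite (bigD1 i) //= big1 => [|j /negbTE ji]; last by rewrite mxE ji scale0r.
by rewrite mxE eqxx addr0 /stringv linearZ /= (H_Ei _ kb) !scalerA mulrC.
Qed.

Lemma stringv_ip_neq k k' b b' i j : lowest k b -> lowest k' b' -> i != j ->
  ip (stringv k b i) (stringv k' b' j) = 0.
Proof. by move=> kb kb' ij; rewrite /stringv ipZl ipZr (ip_Ei_neq kb kb') // !mulr0. Qed.

Lemma stringv_ip0 k k' b b' i : lowest k b -> lowest k' b' -> ip b b' = 0 ->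
  ip (stringv k b i) (stringv k' b' i) = 0.
Proof. by move=> kb kb' bb; rewrite /stringv ipZl ipZr (ip_Ei i kb kb') bb !mulr0. Qed.

Lemma stringv_ip k b b' i : lowest k b -> lowest k b' -> (i <= k.*2)%N ->
  ip (stringv k b i) (stringv k b' i) = ip b b'.
Proof.
move=> kb kb' ik; rewrite /stringv ipZl ipZr (ip_Ei i kb kb') !mulrA -[RHS]mul1r; congr (_ * _).
have -> : \prod_(j < i) (j.+1%:R * ((k.*2)%:R - j%:R)) = string_norm k i * string_norm k i.
  rewrite -big_split; apply: eq_bigr => j _ /=; rewrite -expr2 sqrtCK natrM natrB //.
  by rewrite ltnW // (leq_trans (ltn_ord j)).
have -> : ((string_norm k i)^-1)^* = (string_norm k i)^-1.
  by apply: geC0_conj; rewrite invr_ge0 prodr_ge0 // => j _; rewrite sqrtC_ge0.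
by have := string_norm_neq0 ik; set x := string_norm k i => x0; field.
Qed.

End Strings.

(** * Lowest weight vectors of the fusion product *)

Section Weights.
Variables (C : numClosedFieldType) (N : nat) (z : 'I_N -> C).

Lemma Vwt_sub l m : (Vwt z l m <= Vlt z m)%VS.
Proof. by apply: spanset_min => _ [s [_ sm] ->]; apply: Vlt_word. Qed.

Definition wtproj (l : nat) (v : tpow C N) : tpow C N :=
  [ffun s => if wt s == l then v s else 0].

Fact wtproj_linear l : linear (wtproj l).
Proof.
by move=> a v w; apply/ffunP => s; rewrite !ffunE; case: ifP => _ //; rewrite scaler0 addr0.
Qed.
HB.instance Definition _ l := GRing.isLinear.Build C (tpow C N) (tpow C N) _
  (wtproj l) (wtproj_linear l).

(** The filtration is compatible with weights, as it is spanned by weight vectors. *)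
Lemma Vlt_Vwt (v : tpow C N) l m : v \in Vlt z m -> (forall s, wt s != l -> v s = 0) -> v \in Vwt z l m.
Proof.
move=> vV vl; have -> : v = wtproj l v.
  by apply/ffunP => s; rewrite ffunE; case: eqP => // /eqP/vl.
move: v vV {vl}; apply: (Vlt_lin (A := wtproj l)) => s sm /=.
have [<-|sl] := eqVneq (size s) l.
  have -> : wtproj (size s) (word z s) = word z s; last exact: Vwt_word.
  by apply/ffunP => t; rewrite ffunE; case: eqP => // /eqP/word_wt->.
have -> : wtproj l (word z s) = 0; last exact: mem0v.
apply/ffunP => t; rewrite !ffunE; case: eqP => // tl.
by rewrite word_wt // tl eq_sym.
Qed.

Lemma cur_f_wt l (v : tpow C N) : (forall s, wt s != l -> v s = 0) ->
  forall s, (wt s).+1 != l -> cur z (sl2f C) 0 v s = 0.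
Proof.
move=> vl s sl; rewrite sum_ffunE big1 // => j _; rewrite !ffunE big1 ?scaler0 // => b _.
rewrite mxE; case: eqP => [sj|]; last by rewrite mul0r.
case: eqP => [->|]; last by rewrite mul0r.
rewrite mul1r vl //; suff -> : wt (update s j 1) = (wt s).+1 by [].
rewrite /wt (bigD1 j) //= ffunE eqxx [in RHS](bigD1 j) //= sj add0n add1n; congr S.
by apply: eq_bigr => i /negbTE ij; rewrite ffunE ij.
Qed.

Lemma cur_h_wt l (v : tpow C N) : (forall s, wt s != l -> v s = 0) ->
  cur z (sl2h C) 0 v = ((l.*2)%:R - N%:R) *: v.
Proof.
move=> vl; apply/ffunP => s; rewrite sum_ffunE [RHS]ffunE.
have site_h j : site (sl2h C) j v s = ((s j).*2%:R - 1) * v s.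
  rewrite ffunE (bigD1 (s j)) //= big1 ?addr0 => [|b bs]; last first.
    rewrite !mxE; move: bs; case: (s j) => -[|[|]] // p; case: b => -[|[|]] // q;
    by rewrite //= ?subrr ?subr0 mul0r.
  congr (_ * v _); last first.
    by apply/ffunP => i; rewrite ffunE; case: eqP => [->|].
  rewrite !mxE; case: (s j) => -[|[|]] // p /=.
  by rewrite subr0 -[1.*2]/(1 + 1)%N natrD addrK.
under eq_bigr do rewrite ffunE expr0 [_ *: _]mul1r site_h.
rewrite -mulr_suml sumrB sumr_const card_ord.
have [<-|/vl->] := eqVneq (wt s) l; last by rewrite scaler0 mulr0.
congr ((_ - _) * _); rewrite -natr_sum; congr (_%:R).
by rewrite /wt -mul2n big_distrr /=; apply: eq_bigr => j _; rewrite mul2n.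
Qed.

End Weights.

(** Rank-nullity for the map induced by A from U to W' / W. *)
Lemma dim_preim (K : fieldType) (V : vectType K) (A : 'End(V)) (U W W' : {vspace V}) :
  (A @: U <= W')%VS -> (W <= W')%VS ->
  (\dim U + \dim W <= \dim (U :&: A @^-1: W) + \dim W')%N.
Proof.
move=> AU WW'; set U' := (U :&: _)%VS.
have := limg_ker_dim A U; have := limg_ker_dim A U'.
have := dimv_sum_cap (A @: U) W.
have : (\dim (A @: U + W) <= \dim W')%N by apply: dimvS; rewrite subv_add AU.
have : (\dim (A @: U :&: W) <= \dim (A @: U'))%N.
  apply/dimvS/subvP => w; rewrite memv_cap => /andP[/memv_imgP[u uU ->] AuW].
  by apply: memv_img; rewrite memv_cap uU -memv_preim.
have : (\dim (U :&: lker A) <= \dim (U' :&: lker A))%N.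
  apply/dimvS/subvP => u; rewrite !memv_cap -memv_preim memv_ker => /andP[-> /eqP->].
  by rewrite mem0v eqxx.
lia.
Qed.

Section Fus.
Variables (C : numClosedFieldType) (N : nat) (z : 'I_N -> C).

Fact fusion_class_fin m v : exists D, forall m', (D <= m')%N ->
  (if m' == m then qpi (Vlt z m') (vsproj (Vlt z m'.+1) v) else 0 : gr z m') = 0.
Proof. by exists m.+1 => m' /gtn_eqF->. Qed.

(** The class of v in degree m of the fusion product, meaningful for v in Vlt m.+1. *)
Definition fusion_class m v : fusion z := Dsum (fusion_class_fin m v).

Fact fusion_class_linear m : linear (fusion_class m).
Proof.
move=> a v w; apply: dsumP => m'; rewrite [RHS]dsumDE [in RHS]dsumZE /=.
by case: ifP => _; [rewrite !linearP | rewrite scaler0 addr0].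
Qed.
HB.instance Definition _ m := GRing.isLinear.Build C (tpow C N) (fusion z) _
  (fusion_class m) (fusion_class_linear m).

Lemma fusion_class_deg m v : fusion_deg m (fusion_class m v).
Proof. by move=> m' /negbTE mm /=; rewrite mm. Qed.

Lemma fusion_class_eq0 m v : v \in Vlt z m.+1 -> fusion_class m v = 0 <-> v \in Vlt z m.
Proof.
move=> vV; split => [|vm].
  move=> /(congr1 (fun w : fusion z => w m)) /=; rewrite eqxx -(linear0 (qpi _)).
  by move=> /qpiP; rewrite -linearB subr0 /= vsprojK.
apply: dsumP => m' /=; case: eqP => [->|//]; rewrite -[RHS](linear0 (qpi _)).
by apply/qpiP; rewrite -linearB subr0 /= vsprojK.
Qed.

Lemma fusion_class_act m x v : v \in Vlt z m.+1 ->
  fusion_act z x (fusion_class m v) = fusion_class m (cur z x 0 v).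
Proof.
move=> vV; apply: dsumP => m' /=; case: eqP => [->|_]; last exact: linear0.
by rewrite gr_actE vsprojK.
Qed.

End Fus.

(** Let K consist of the v of weight l and degree at most m whose image under f has
    smaller degree.  By dim_preim, K exceeds the vectors of degree less than m by at
    least the number of tableaux; a complement of these in K embeds into degree m of
    the fusion product. *)
Lemma lowest_family (C : numClosedFieldType) n (z : 'I_n.*2 -> C)
    (ip : {dot (fusion z) for (@conjC C)}) k m : injective z -> (k <= n)%N ->
  exists s : seq (fusion z),
    [/\ size s = #|[pred t : tab n k | maj t == m]|,
        forall i, (i < size s)%N -> fusion_deg m s`_i /\ lowest (fusion_rep z) k s`_i &
        forall i j, (i < size s)%N -> (j < size s)%N -> ip s`_i s`_j = (i == j)%:R].
Proof.
move=> z_inj kn; set p := #|_|; pose l := (n - k)%N.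
pose F := linfun (cur z (sl2f C) 0).
pose K := (Vwt z l m.+1 :&: F @^-1: Vlt z m)%VS.
have cS a b : count (fun s => sumn s < m.+1)%N (boxes a b) =
    (count (fun s => sumn s < m)%N (boxes a b) + count (fun s => sumn s == m) (boxes a b))%N.
  rewrite -count_predUI [X in (_ + X)%N](_ : _ = 0%N) ?addn0.
    by apply: eq_count => s /=; rewrite ltnS leq_eqVlt orbC.
  by rewrite (eq_count (a2 := pred0)) ?count_pred0 // => s /=; case: ltngtP.
have Nl : (n.*2 - l = n + k)%N by rewrite /l; lia.
have lN : (l <= n.*2)%N by rewrite /l; lia.
have suppl m' v : v \in Vwt z l m' -> forall s, wt s != l -> v s = 0.
  by move=> vV s; apply: Vwt_supp vV.
have Fstab m' v : v \in Vlt z m' -> cur z (sl2f C) 0 v \in Vlt z m'.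
  by move=> vV; apply: Vlt_cur.
have dimK : (\dim (Vwt z l m) + p <= \dim K)%N.
  have := tab_boxes m kn; rewrite -/p -/l.
  have D m' : \dim (Vwt z l m') = count (fun s => sumn s < m')%N (boxes (n + k) l).
    by rewrite dim_Vwt // Nl.
  case El : l => [|l']; cbv iota; rewrite -El => Ep.
    have -> : K = Vwt z l m.+1.
      apply/capv_idPl/subvP => v vV; rewrite -memv_preim lfunE /=.
      suff -> : cur z (sl2f C) 0 v = 0 by apply: mem0v.
      apply/ffunP => s; rewrite [RHS]ffunE; apply: (cur_f_wt z (suppl _ _ vV)).
      by rewrite El.
    by rewrite !D cS -Ep /= addn0.
  have Fl m' v : v \in Vwt z l m' -> cur z (sl2f C) 0 v \in Vwt z l' m'.
    move=> vV; apply: Vlt_Vwt; first exact/Fstab/(subvP (Vwt_sub z l m')).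
    by move=> s sl; apply: (cur_f_wt z (suppl _ _ vV)); rewrite El eqSS.
  have FU : (F @: Vwt z l m.+1 <= Vwt z l' m.+1)%VS.
    by apply/subvP => _ /memv_imgP[v vV ->]; rewrite lfunE /= Fl.
  have WW : (Vwt z l' m <= Vwt z l' m.+1)%VS.
    by apply: spanset_min => _ [s [<- sm] ->]; apply/Vwt_word/leqW.
  have := dim_preim FU WW.
  have : (\dim (Vwt z l m.+1 :&: F @^-1: Vwt z l' m) <= \dim K)%N.
    apply/dimvS/capvS => //; apply/subvP => v; rewrite -!memv_preim.
    exact/subvP/Vwt_sub.
  have l'N : (l' <= n.*2)%N by lia.
  have Nl' : (n.*2 - l' = (n + k).+1)%N by rewrite /l in El; lia.
  rewrite !D !cS !(dim_Vwt z_inj _ l'N) Nl' cS => XK le.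
  have arith (a b d e x y q : nat) : (x <= y -> a + b + d <= x + (d + e) -> q + e = b ->
    a + q <= y)%N by lia.
  exact: arith XK le Ep.
(* the complement on which passing to the degree m piece is injective *)
pose U := (K :\: Vwt z l m)%VS.
have UK v : v \in U -> v \in K by apply/subvP/diffvSl.
have UV v : v \in U -> v \in Vlt z m.+1.
  by move/UK; rewrite memv_cap => /andP[+ _]; apply/subvP/Vwt_sub.
have Ul v : v \in U -> forall s, wt s != l -> v s = 0.
  by move/UK; rewrite memv_cap => /andP[+ _]; apply: suppl.
have fI v : v \in U -> fusion_class z m v = 0 -> v = 0.
  move=> vU /(fusion_class_eq0 (UV _ vU)) vm; apply/eqP; rewrite -memv0 -(capv_diff K (Vwt z l m)).
  by rewrite memv_cap vU; apply: Vlt_Vwt vm (Ul _ vU).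
have pU : (p <= \dim U)%N.
  have := dimv_cap_compl K (Vwt z l m); rewrite -/U.
  have := dimvS (capvSr K (Vwt z l m)); lia.
have [s [ss sU so]] := gram_schmidt ip (f := fusion_class z m) fI pU.
exists (map (fusion_class z m) s); rewrite size_map ss; split=> // [i ilt|i j ilt jlt]; last first.
  by rewrite !(nth_map 0) ?ss // so.
rewrite (nth_map 0) ?ss //; split; first exact: fusion_class_deg.
have sK : s`_i \in U by apply/sU/mem_nth; rewrite ss.
split; rewrite /= fusion_class_act ?UV //.
  apply/(fusion_class_eq0 (Fstab _ _ (UV _ sK))).
  by have := UK _ sK; rewrite memv_cap -memv_preim lfunE => /andP[_].
rewrite (cur_h_wt z (Ul _ sK)) linearZ; congr (_ *: _).
have -> : (l.*2 = n.*2 - k.*2)%N by rewrite /l; lia.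
by rewrite natrB ?leq_double //; ring.
Qed.

(** * Dimension count in the fusion product *)

Section Lift.
Variables (C : numClosedFieldType) (N : nat) (z : 'I_N -> C).

(** Projecting along Vlt m to a fixed complement identifies each graded piece with a
    subspace of the tensor power; with gr_lifts a truncated fusion product embeds into
    a space of known dimension. *)
Definition gr_proj (m : nat) : 'End(tpow C N) := daddv_pi (Vlt z m)^C (Vlt z m).

Lemma gr_proj_eq0 m v : v \in Vlt z m -> gr_proj m v = 0.
Proof.
move=> vm; have cap : ((Vlt z m)^C :&: Vlt z m = 0)%VS by rewrite capvC capv_compl.
have := daddv_pi_add (w := v) cap; rewrite addvC addv_complf memvf => /(_ isT).
by rewrite (daddv_pi_id _ vm) 1?capvC // -[RHS]add0r => /addIr.
Qed.

Lemma gr_proj_sub m v : v - gr_proj m v \in Vlt z m.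
Proof.
have cap : ((Vlt z m)^C :&: Vlt z m = 0)%VS by rewrite capvC capv_compl.
have := daddv_pi_add (w := v) cap; rewrite addvC addv_complf memvf => /(_ isT) E.
by rewrite -{1}E addrC addKr memv_pi.
Qed.

Definition gr_lift (m : nat) (q : gr z m) : tpow C N := gr_proj m (vsval (repr q)).

Lemma gr_lift_qpi m (u : subvs_of (Vlt z m.+1)) : gr_lift (qpi (Vlt z m) u : gr z m) = gr_proj m (vsval u).
Proof.
apply/eqP; rewrite -subr_eq0 -linearB; apply/eqP/gr_proj_eq0/qpiP.
by rewrite /qpi reprK.
Qed.

Fact gr_lift_linear m : linear (@gr_lift m).
Proof.
move=> a q r; have [u ->] := qpi_surj q; have [v ->] := qpi_surj r.
by rewrite -linearP !gr_lift_qpi !linearP.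
Qed.
HB.instance Definition _ m := GRing.isLinear.Build C (gr z m) (tpow C N) _
  (@gr_lift m) (@gr_lift_linear m).

Lemma gr_lift_mem m (q : gr z m) : gr_lift q \in Vlt z m.+1.
Proof.
have [u ->] := qpi_surj q; rewrite gr_lift_qpi -[gr_proj _ _](subKr (vsval u)).
by rewrite memvB ?subvsP //; apply: (subvP (VltS z (leqnSn m))); apply: gr_proj_sub.
Qed.

Lemma gr_lift_inj m (q : gr z m) : gr_lift q \in Vlt z m -> q = 0.
Proof.
have [u ->] := qpi_surj q; rewrite gr_lift_qpi => lm; rewrite -(linear0 (qpi _)).
apply/qpiP; rewrite -linearB subr0 /= -(subrK (gr_proj m (vsval u)) (vsval u)).
by rewrite memvD // gr_proj_sub.
Qed.

Definition gr_lifts (D : nat) (w : fusion z) : tpow C N := \sum_(m < D) gr_lift (w m).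

Fact gr_lifts_linear D : linear (gr_lifts D).
Proof.
move=> a v w; rewrite /gr_lifts scaler_sumr -big_split; apply: eq_bigr => m _ /=.
by exact: linearP.
Qed.
HB.instance Definition _ D := GRing.isLinear.Build C (fusion z) (tpow C N) _
  (gr_lifts D) (gr_lifts_linear D).

Lemma gr_lifts_mem D w : gr_lifts D w \in Vlt z D.
Proof.
apply: memv_suml => m _; apply: (subvP (VltS z (ltn_ord m))); exact: gr_lift_mem.
Qed.

(** Only the top piece lies outside Vlt D, so it must vanish; then go down. *)
Lemma gr_lifts_inj D w : gr_lifts D w = 0 -> forall m, (m < D)%N -> w m = 0.
Proof.
elim: D => // D IHD; rewrite /gr_lifts big_ord_recr /= -/(gr_lifts D w) => wD.
have wD0 : w D = 0.
  apply: gr_lift_inj; rewrite -[gr_lift _](addKr (gr_lifts D w)) wD addr0 memvN.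
  exact: gr_lifts_mem.
move=> m; rewrite ltnS leq_eqVlt => /orP[/eqP->//|]; apply: IHD.
by move: wD; rewrite wD0 linear0 addr0.
Qed.

(** An injective map from a space at least as large as the tensor power is onto: in the
    finitely many degrees that are involved, the fusion product embeds into the tensor
    power. *)
Lemma fusion_onto (X : vectType C) (f : {linear X -> fusion z}) D :
  injective f -> (\dim {:tpow C N} <= \dim {:X})%N ->
  (forall x m, (D <= m)%N -> f x m = 0) -> forall w, exists x, w = f x.
Proof.
move=> fI dX fD w; have [E wE] := dsum_fin w; pose M := maxn D E.
have fM x m : (M <= m)%N -> f x m = 0 by rewrite geq_max => /andP[/fD].
pose g := linfun (gr_lifts M \o f).
have big (v : fusion z) : (forall m, (M <= m)%N -> v m = 0) -> gr_lifts M v = 0 -> v = 0.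
  move=> vM /gr_lifts_inj v0; apply: dsumP => m.
  by case: (ltnP m M) => [/v0|/vM].
have g0 : (fullv :&: lker g = 0)%VS.
  apply/eqP; rewrite -subv0; apply/subvP => x; rewrite memv_cap memv_ker lfunE /= memv0.
  case/andP=> _ /eqP/(big _ (fM x)) fx; apply/eqP/fI; by rewrite fx linear0.
have : limg g = fullv.
  by apply/eqP; rewrite eqEdim subvf (limg_dim_eq g0).
move=> gf; have : gr_lifts M w \in limg g by rewrite gf memvf.
case/memv_imgP => x _; rewrite lfunE /= => E1; exists x.
apply/eqP; rewrite -subr_eq0; apply/eqP/big => [m Mm|]; last first.
  by rewrite linearB /= E1 subrr.
rewrite dsumDE dsumNE fM // wE ?subr0 //.
by move: Mm; rewrite geq_max => /andP[].
Qed.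

End Lift.

(** * The tableau space *)

Section Tableaux.
Variables (C : numClosedFieldType) (n : nat).

Lemma big_xidx (R : Type) (idx : R) (op : Monoid.com_law idx) (F : xidx n -> R) :
  \big[op/idx]_y F y = \big[op/idx]_(k < n.+1) \big[op/idx]_(t : tab n k) \big[op/idx]_j F (xin t j).
Proof.
transitivity (\big[op/idx]_(k < n.+1)
    \big[op/idx]_(p : (tab n k * 'I_(k.*2.+1))%type) F (xin p.1 p.2)).
  by rewrite sig_big_dep; apply: eq_bigr => -[k [t j]].
by apply: eq_bigr => k _; rewrite pair_bigA.
Qed.

Lemma card_xidx : #|xidx n| = (2 ^ n.*2)%N.
Proof.
rewrite -sum1_card -sum_card_tab big_xidx; apply: eq_bigr => k _.
under eq_bigr do rewrite sum1_card card_ord.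
by rewrite sum_nat_const.
Qed.

Lemma xin_eq (k : 'I_n.+1) (t u : tab n k) i j :
  (xin t i == xin u j) = (t == u) && (i == j).
Proof. by rewrite eq_Tagged. Qed.

Lemma xtensE (k : 'I_n.+1) (u : irr C k) (t : tab n k) y :
  xtens u t y = \sum_j u j 0 * (y == xin t j)%:R.
Proof. by rewrite sum_ffunE; apply: eq_bigr => j _; rewrite !ffunE. Qed.

Lemma xtens_xin (k : 'I_n.+1) (u : irr C k) (t t' : tab n k) j :
  xtens u t (xin t' j) = u j 0 * (t' == t)%:R.
Proof.
rewrite xtensE (bigD1 j) //= big1 ?addr0 => [|i ij].
  by rewrite xin_eq eqxx andbT.
by rewrite xin_eq [j == i]eq_sym (negbTE ij) andbF mulr0.
Qed.

Lemma xtens_neq (k k' : 'I_n.+1) (u : irr C k) (t : tab n k) (t' : tab n k') j :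
  k' != k -> xtens u t (xin t' j) = 0.
Proof.
move=> kk; rewrite xtensE big1 // => i _; case: eqP; rewrite ?mulr0 //.
by move/(congr1 (fun y => tag y)) => /= /eqP; rewrite (negbTE kk).
Qed.

Lemma xtens_deg (k : 'I_n.+1) (u : irr C k) (t : tab n k) : XN_deg (maj t) (xtens u t).
Proof.
move=> k' t' j mt; rewrite xtensE big1 // => i _; case: eqP; rewrite ?mulr0 //.
by move/(congr1 (fun y : xidx n => maj (tagged y).1)) => /= e; rewrite e eqxx in mt.
Qed.

Lemma xtens_linear (k : 'I_n.+1) (t : tab n k) : linear (fun u : irr C k => xtens u t).
Proof.
move=> a u v; apply/ffunP => y; rewrite !ffunE !xtensE scaler_sumr -big_split.
by apply: eq_bigr => j _; rewrite !mxE mulrDl -[_ *: _]/(_ * _) mulrA.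
Qed.

Lemma xact_xtens (M : forall k, 'M[C]_(k.*2.+1)) (k : 'I_n.+1) (u : irr C k) (t : tab n k) :
  xact M (xtens u t) = xtens (M k *m u) t.
Proof.
apply/ffunP => -[k' [t' j]]; rewrite ffunE /= -/(xin t' j).
have [kk|kk] := eqVneq k' k; last first.
  by rewrite xtens_neq // big1 // => i _; rewrite xtens_neq ?mulr0.
subst k'; rewrite xtens_xin mxE mulr_suml; apply: eq_bigr => i _.
by rewrite xtens_xin mulrA.
Qed.

Definition xcomb (k : 'I_n.+1) (c : tab n k -> C) (u : irr C k) : XN C n :=
  \sum_t c t *: xtens u t.

Fact xcomb_linear k c : linear (@xcomb k c).
Proof.
move=> a u v; rewrite /xcomb scaler_sumr -big_split; apply: eq_bigr => t _ /=.
by rewrite xtens_linear scalerDr !scalerA mulrC.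
Qed.

Lemma xcomb_xin (k : 'I_n.+1) (c : tab n k -> C) u t j : xcomb c u (xin t j) = c t * u j 0.
Proof.
rewrite sum_ffunE (bigD1 t) //= big1 ?addr0 => [|t' tt].
  by rewrite ffunE xtens_xin eqxx mulr1.
by rewrite ffunE xtens_xin eq_sym (negbTE tt) mulr0 scaler0.
Qed.

Lemma xcomb_hom (k : 'I_n.+1) (c : tab n k -> C) : sl2_hom (irr_rep C k) (XN_rep C n) (xcomb c).
Proof.
by split=> u; rewrite /xcomb linear_sum; apply: eq_bigr => t _; rewrite linearZ /= xact_xtens.
Qed.

(** The lowest weight vector generates the irreducible module. *)
Lemma irr_ind k (P : irr C k -> Prop) :
  (forall a u v, P u -> P v -> P (a *: u + v)) -> P (delta_mx 0 0) ->
  (forall u, P u -> P (irrE C k *m u)) -> forall u, P u.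
Proof.
move=> PL P0 PE; have P00 : P 0 by have := PL (-1) _ _ P0 P0; rewrite scaleN1r addNr.
have PZ a u : P u -> P (a *: u) by move=> Pu; rewrite -[_ *: _]addr0; apply: PL.
have Pj j (jk : (j < k.*2.+1)%N) : P (delta_mx (Ordinal jk) 0).
  elim: j jk => [|j IHj] jk.
    by have -> : Ordinal jk = 0 by apply: val_inj.
  have jk' : (j < k.*2.+1)%N by apply: ltnW.
  have s0 : sqrtC (j.+1 * (k.*2 - j))%:R != 0 :> C.
    by rewrite sqrtC_eq0 pnatr_eq0 muln_eq0 /= subn_eq0 -ltnNge.
  suff -> : delta_mx (Ordinal jk) 0 = (sqrtC (j.+1 * (k.*2 - j))%:R)^-1 *:
     (irrE C k *m delta_mx (Ordinal jk') 0) :> irr C k by apply/PZ/PE/IHj.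
  apply/matrixP => i i0; rewrite -colE !mxE (ord1 i0) eqxx andbT -val_eqE /=.
  by case: eqP => _; rewrite ?mulr0 ?mulVf.
move=> u; have -> : u = \sum_j u j 0 *: delta_mx j 0.
  by rewrite {1}[u]matrix_sum_delta; apply: eq_bigr => j _; rewrite big_ord1.
elim/big_ind: _ => // [u1 u2 P1 P2|[j jk] _]; last exact/PZ/Pj.
by rewrite -[u1]scale1r; apply: PL.
Qed.

(** The equation for f removes all coordinates except those of u_0, the equation for h
    all summands except the k-th. *)
Lemma XN_lowest (x : XN C n) (k : 'I_n.+1) : lowest (XN_rep C n) k x ->
  x = xcomb (fun t : tab n k => x (xin t 0)) (delta_mx 0 0).
Proof.
case=> Fx Hx; apply/ffunP => -[k' [t j]]; rewrite -/(xin t j).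
have x0 (j' : nat) (jk : (j'.+1 < k'.*2.+1)%N) : x (xin t (Ordinal jk)) = 0.
  have jk' : (j' < k'.*2.+1)%N by apply: ltnW.
  have /ffunP/(_ (xin t (Ordinal jk'))) := Fx; rewrite !ffunE /= (bigD1 (Ordinal jk)) //=.
  rewrite big1 => [|i ij]; last first.
    by rewrite !mxE /= ifF ?mul0r //; apply: negbTE ij.
  rewrite !mxE /= eqxx addr0 => /eqP; rewrite mulf_eq0 sqrtC_eq0 pnatr_eq0 muln_eq0 /=.
  by rewrite subn_eq0 leqNgt (jk : j' < k'.*2)%N => /eqP.
have [kk|kk] := eqVneq k' k.
  subst k'; rewrite xcomb_xin mxE andbT; case: j => -[|j] jk.
    have -> : Ordinal jk = 0 by apply: val_inj.
    by rewrite eqxx mulr1.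
  by rewrite x0 -val_eqE mulr0.
rewrite sum_ffunE big1 => [|t' _]; last by rewrite ffunE xtens_neq ?scaler0.
case: j => -[|j] jk; last exact: x0.
have /ffunP/(_ (xin t (Ordinal jk))) := Hx; rewrite !ffunE /= (bigD1 (Ordinal jk)) //=.
rewrite big1 => [|i ij]; last by rewrite mxE eq_sym (negbTE ij) mul0r.
rewrite mxE eqxx addr0 double0 sub0r -[_ *: _]/(_ * _) => /eqP.
rewrite -subr_eq0 -mulrBl mulf_eq0 opprK addrC subr_eq0 eqr_nat (inj_eq double_inj).
by rewrite val_eqE eq_sym (negbTE kk) => /eqP.
Qed.

(** Schur's lemma: a homomorphism is determined by the image of the lowest weight
    vector, which is a lowest weight vector of the same weight. *)
Lemma hom_XN (k : 'I_n.+1) (f : {linear irr C k -> XN C n}) :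
  sl2_hom (irr_rep C k) (XN_rep C n) f <-> exists c, forall u, f u = xcomb c u.
Proof.
split=> [[fE fF fH]|[c fc]]; last first.
  by have [gE gF gH] := xcomb_hom c; split=> u; rewrite !fc.
pose x := f (delta_mx 0 0).
have xl : lowest (XN_rep C n) k x.
  split; rewrite /x.
    rewrite -fF /= -colE; suff -> : col 0 (irrF C k) = 0 by rewrite linear0.
    by apply/matrixP => i i0; rewrite !mxE.
  rewrite -fH /= -colE -linearZ; congr (f _); apply/matrixP => i i0; rewrite !mxE (ord1 i0) eqxx andbT.
  by case: eqP => _; rewrite ?mulr0 // double0 sub0r mulr1.
exists (fun t : tab n k => x (xin t 0)); apply: irr_ind => [a u v fu fv||u fu].
- by rewrite linearP fu fv xcomb_linear.
- exact: XN_lowest xl.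
by have [gE _ _] := xcomb_hom (fun t : tab n k => x (xin t 0)); rewrite [LHS]fE [RHS]gE fu.
Qed.

End Tableaux.

(** * The isomorphism *)

Lemma dsum_sumE (K : nzRingType) (Q : nat -> lmodType K) (I : Type) (r : seq I)
    (P : pred I) (F : I -> dsum Q) m :
  (\sum_(i <- r | P i) F i) m = \sum_(i <- r | P i) F i m.
Proof. by apply: (big_morph (fun v : dsum Q => v m)). Qed.

Section Isomorphism.
Variables (C : numClosedFieldType) (n : nat) (z : 'I_n.*2 -> C).
Hypothesis z_inj : injective z.
Variable ip : {dot (fusion z) for (@conjC C)}.
Hypothesis ip_unitary : sl2_unitary (fusion_rep z) ip.
Hypothesis ip_graded : forall (m m' : nat) (v w : fusion z), m != m' ->
  fusion_deg m v -> fusion_deg m' w -> ip v w = 0.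

Lemma fusion_act_deg x m v : fusion_deg m v -> fusion_deg m (fusion_act z x v).
Proof. by move=> vm m' mm; rewrite /= (vm m' mm) linear0. Qed.

Lemma stringv_deg k b j m : fusion_deg m b -> fusion_deg m (stringv (fusion_rep z) k b j).
Proof.
move=> bm; have Em : fusion_deg m (iter j (repE (fusion_rep z)) b).
  by elim: j => //= j; apply: fusion_act_deg.
by move=> m' mm; rewrite dsumZE (Em m' mm) scaler0.
Qed.

(** The families for different m have different degrees; within a family, a tableau is
    identified with its rank among those with the same major index. *)
Lemma lowest_basis : exists b : forall k : 'I_n.+1, tab n k -> fusion z,
  [/\ forall (k : 'I_n.+1) t, fusion_deg (maj t) (b k t),
      forall (k : 'I_n.+1) t, lowest (fusion_rep z) k (b k t) &
      forall (k : 'I_n.+1) t u, ip (b k t) (b k u) = (t == u)%:R].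
Proof.
pose P (km : 'I_n.+1 * nat) (s : seq (fusion z)) :=
  [/\ size s = #|[pred t : tab n km.1 | maj t == km.2]|,
      forall i, (i < size s)%N -> fusion_deg km.2 s`_i /\ lowest (fusion_rep z) km.1 s`_i &
      forall i j, (i < size s)%N -> (j < size s)%N -> ip s`_i s`_j = (i == j)%:R].
have /choice[s sP] : forall km, exists s, P km s.
  by move=> [k m]; apply: lowest_family; rewrite // -ltnS.
pose pr (k : 'I_n.+1) m := [pred t : tab n k | maj t == m].
pose ix (k : 'I_n.+1) (t : tab n k) := index t (enum (pr k (maj t))).
have ixP (k : 'I_n.+1) (t : tab n k) : (ix k t < size (s (k, maj t)))%N.
  have [-> _ _] := sP (k, maj t); rewrite cardE index_mem mem_enum inE; exact: eqxx.
exists (fun (k : 'I_n.+1) t => (s (k, maj t))`_(ix k t)); split=> [k t|k t|k t u].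
- by have [_ H _] := sP (k, maj t); have [] := H _ (ixP k t).
- by have [_ H _] := sP (k, maj t); have [] := H _ (ixP k t).
have [mtu|mtu] := eqVneq (maj t) (maj u); last first.
  have [_ Ht _] := sP (k, maj t); have [_ Hu _] := sP (k, maj u).
  rewrite (ip_graded mtu (proj1 (Ht _ (ixP k t))) (proj1 (Hu _ (ixP k u)))).
  by have [e|//] := eqVneq t u; rewrite e eqxx in mtu.
have := ixP k u; rewrite /ix -mtu => iu; have [_ _ H] := sP (k, maj t).
rewrite H //; last exact: ixP.
congr (nat_of_bool _)%:R; apply/eqP/eqP => [|->//]; apply: (index_inj t).
  by rewrite mem_enum inE.
by rewrite mem_enum inE mtu.
Qed.

Section Psi.
Variable b : forall k : 'I_n.+1, tab n k -> fusion z.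
Hypothesis b_deg : forall (k : 'I_n.+1) (t : tab n k), fusion_deg (maj t) (b t).
Hypothesis b_low : forall (k : 'I_n.+1) (t : tab n k), lowest (fusion_rep z) k (b t).
Hypothesis b_ip : forall (k : 'I_n.+1) (t u : tab n k), ip (b t) (b u) = (t == u)%:R.

Definition bvec (y : xidx n) : fusion z :=
  stringv (fusion_rep z) (tag y) (b (tagged y).1) (tagged y).2.

Definition xmaj (y : xidx n) : nat := maj (tagged y).1.

Lemma bvec_deg y : fusion_deg (xmaj y) (bvec y).
Proof. exact/stringv_deg/b_deg. Qed.

Lemma bvec_ip x y : ip (bvec x) (bvec y) = (x == y)%:R.
Proof.
case: x y => [k [t i]] [k' [u j]]; rewrite -/(xin t i) -/(xin u j).
have [kk|kk] := eqVneq k k'; last first.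
  have -> : (xin t i == xin u j) = false.
    by apply/eqP => /(congr1 (fun y => tag y))/eqP; rewrite /= (negbTE kk).
  rewrite /bvec /=; have [->|ij] := eqVneq (i : nat) j; last first.
    exact: (stringv_ip_neq ip_unitary (b_low t) (b_low u) ij).
  apply: (stringv_ip0 ip_unitary) => //; exact: (ip_lowest_neq ip_unitary (b_low t) (b_low u)).
subst k'; rewrite xin_eq /bvec /=; have [<-|ij] := eqVneq i j.
  by rewrite (stringv_ip ip_unitary) ?b_ip ?andbT // -ltnS.
rewrite andbF; exact: (stringv_ip_neq ip_unitary (b_low t) (b_low u) ij).
Qed.

Definition Psi (x : XN C n) : fusion z := \sum_y x y *: bvec y.

Fact Psi_linear : linear Psi.
Proof.
move=> a x x'; rewrite /Psi scaler_sumr -big_split; apply: eq_bigr => y _ /=.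
by rewrite !ffunE scalerDl [in RHS]scalerA.
Qed.
HB.instance Definition _ := GRing.isLinear.Build C (XN C n) (fusion z) _ Psi Psi_linear.

Lemma Psi_bvec x y : ip (Psi x) (bvec y) = x y.
Proof.
rewrite linear_sumlz (bigD1 y) //= ipZl bvec_ip eqxx mulr1 big1 ?addr0 // => y' yy.
by rewrite ipZl bvec_ip (negbTE yy) mulr0.
Qed.

Lemma Psi_isometry x x' : ip (Psi x) (Psi x') = xdot x x'.
Proof.
rewrite {2}/Psi linear_sumr; apply: eq_bigr => y _.
transitivity ((x' y)^* * ip (Psi x) (bvec y)); first exact: ipZr.
by rewrite Psi_bvec mulrC.
Qed.

Lemma Psi_inj : injective Psi.
Proof. by move=> x x' xx; apply/ffunP => y; rewrite -!Psi_bvec xx. Qed.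

Lemma Psi_act (M : forall k, 'M[C]_(k.*2.+1)) (A : {linear fusion z -> fusion z}) :
  (forall (k : 'I_n.+1) (t : tab n k) i,
     A (bvec (xin t i)) = \sum_j M k j i *: bvec (xin t j)) ->
  forall x, Psi (xact M x) = A (Psi x).
Proof.
move=> AM x; rewrite /Psi linear_sum !big_xidx; apply: eq_bigr => k _; apply: eq_bigr => t _.
transitivity (\sum_j \sum_i (M k j i * x (xin t i)) *: bvec (xin t j)).
  by apply: eq_bigr => j _; rewrite ffunE scaler_suml.
rewrite exchange_big; apply: eq_bigr => i _; rewrite linearZ /= AM scaler_sumr.
by apply: eq_bigr => j _; rewrite [RHS]scalerA [in RHS]mulrC.
Qed.

Lemma Psi_hom : sl2_hom (XN_rep C n) (fusion_rep z) Psi.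
Proof.
split; apply: Psi_act => k t i.
- exact: (stringvE ip_unitary i (b_low t)).
- exact: (stringvF i (b_low t)).
- exact: (stringvH i (b_low t)).
Qed.

(** The coordinates are inner products with homogeneous vectors. *)
Lemma Psi_deg m x : XN_deg m x <-> fusion_deg m (Psi x).
Proof.
split=> [xm m' mm|pm k t j mt].
  rewrite dsum_sumE big1 // => y _; rewrite dsumZE.
  have [ym|ym] := eqVneq (xmaj y) m; last first.
    by case: y ym => [k [t j]] ym; rewrite (xm k t j ym) scale0r.
  by rewrite bvec_deg ?scaler0 // ym.
rewrite -(Psi_bvec x (xin t j)); apply: (ip_graded _ pm (@bvec_deg (xin t j))).
by rewrite eq_sym.
Qed.

(** Psi is injective, being isometric, and its source has dimension 2^N. *)
Lemma Psi_onto v : exists x, v = Psi x.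
Proof.
(* the image of Psi lies in degrees below D *)
pose D := (\max_y xmaj y).+1.
apply: (@fusion_onto _ _ z _ Psi D Psi_inj) => [|x m Dm].
  rewrite !dimvf; change (#|{ffun 'I_n.*2 -> 'I_2}| * dim C^o <= #|xidx n| * dim C^o)%N.
  by rewrite card_xidx card_ffun !card_ord.
rewrite dsum_sumE big1 // => y _; rewrite dsumZE bvec_deg ?scaler0 //.
apply: contraL Dm => /eqP->; rewrite -ltnNge ltnS; exact: (leq_bigmax y).
Qed.

End Psi.

Lemma fusion_iso : exists Phi : {linear fusion z -> XN C n},
  [/\ bijective Phi, sl2_hom (fusion_rep z) (XN_rep C n) Phi,
      isometry (@xdot C n) ip Phi &
      forall (m : nat) (v : fusion z), fusion_deg m v <-> XN_deg m (Phi v)].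
Proof.
have [b [b_deg b_low b_ip]] := lowest_basis.
have /choice[g gP] := Psi_onto b_deg b_low b_ip.
have PsiI := Psi_inj b_low b_ip.
have gK x : g (Psi b x) = x by apply: PsiI; rewrite -gP.
have gL : linear g by move=> a v w; apply: PsiI; rewrite -gP linearP /= -!gP.
pose gm := GRing.isLinear.Build C (fusion z) (XN C n) _ g gL.
pose Phi : {linear fusion z -> XN C n} := HB.pack g gm.
have [hE hF hH] := Psi_hom b_low.
exists Phi; split.
- by exists (Psi b) => [v|x]; rewrite /= -?gP ?gK.
- by split=> v; apply: PsiI; rewrite ?hE ?hF ?hH -!gP.
- by move=> v w; rewrite /= -(Psi_isometry b_low b_ip) -!gP.
by move=> m v; rewrite (Psi_deg b_deg b_low b_ip) -gP.
Qed.

(** By hom_XN for Phi \o psi; the degree condition is read off at u_0. *)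
Lemma mult_tableaux (Phi : {linear fusion z -> XN C n}) : bijective Phi ->
  sl2_hom (fusion_rep z) (XN_rep C n) Phi ->
  (forall (m : nat) (v : fusion z), fusion_deg m v <-> XN_deg m (Phi v)) ->
  forall k : 'I_n.+1,
    (forall psi : {linear irr C k -> fusion z},
      mult (fusion_rep z) psi <->
      exists c : tab n k -> C, forall u : irr C k, Phi (psi u) = \sum_t c t *: xtens u t) /\
    (forall (i : nat) (psi : {linear irr C k -> fusion z}),
      (mult (fusion_rep z) psi /\ forall u, fusion_deg i (psi u)) <->
      exists c : tab n k -> C, forall u : irr C k,
        Phi (psi u) = \sum_(t | maj t == i) c t *: xtens u t).
Proof.
move=> /bij_inj PhiI [hE hF hH] Phi_deg k.
have part1 (psi : {linear irr C k -> fusion z}) : mult (fusion_rep z) psi <->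
    exists c : tab n k -> C, forall u : irr C k, Phi (psi u) = \sum_t c t *: xtens u t.
  have := hom_XN (Phi \o psi); rewrite /= => <-; split=> -[gE gF gH].
    by split=> v; rewrite /= ?gE ?gF ?gH ?hE ?hF ?hH.
  by split=> v; apply: PhiI; rewrite ?hE ?hF ?hH; [apply: gE|apply: gF|apply: gH].
split=> // i psi; split=> [[/part1[c cP] pd]|[c cP]].
  exists c => u; rewrite cP (bigID (fun t => maj t == i)) /= [X in _ + X]big1 ?addr0 // => t ti.
  have /Phi_deg/(_ k t 0 ti) := pd (delta_mx 0 0).
  by rewrite cP xcomb_xin mxE !eqxx mulr1 => ->; rewrite scale0r.
have cE u : Phi (psi u) = xcomb (fun t => if maj t == i then c t else 0) u.
  rewrite cP big_mkcond; apply: eq_bigr => t _; by case: ifP; rewrite ?scale0r.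
split; first by apply/part1; exists (fun t => if maj t == i then c t else 0).
move=> u; apply/Phi_deg; rewrite cP => k' t' j ti.
rewrite sum_ffunE big1 // => t /eqP mt; rewrite ffunE.
by rewrite (@xtens_deg C n k u t) ?scaler0 // mt.
Qed.

End Isomorphism.

Theorem proposition1 (R : realType) (n : nat) (z : 'I_(n.*2) -> R[i])
    (z_inj : injective z)
    (ip : {dot (fusion z) for (@conjC R[i])})
    (ip_unitary : sl2_unitary (fusion_rep z) ip)
    (ip_graded : forall (m m' : nat) (v w : fusion z), m != m' ->
       fusion_deg m v -> fusion_deg m' w -> ip v w = 0) :
  exists Phi : {linear fusion z -> XN R[i] n},
    [/\ bijective Phi,
        sl2_hom (fusion_rep z) (XN_rep R[i] n) Phi,
        isometry (@xdot R[i] n) ip Phi,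
        forall (m : nat) (v : fusion z), fusion_deg m v <-> XN_deg m (Phi v)
      & forall k : 'I_n.+1,
          (forall psi : {linear irr R[i] k -> fusion z},
             mult (fusion_rep z) psi <->
             exists c : tab n k -> R[i], forall u : irr R[i] k,
               Phi (psi u) = \sum_t c t *: xtens u t) /\
          (forall (i : nat) (psi : {linear irr R[i] k -> fusion z}),
             (mult (fusion_rep z) psi /\ forall u, fusion_deg i (psi u)) <->
             exists c : tab n k -> R[i], forall u : irr R[i] k,
               Phi (psi u) = \sum_(t | maj t == i) c t *: xtens u t)].
Proof.
have [Phi [Phi_bij Phi_hom Phi_iso Phi_deg]] := fusion_iso z_inj ip_unitary ip_graded.
exists Phi; split=> // k.
exact: (mult_tableaux Phi_bij Phi_hom Phi_deg).
Qed.
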